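(* For $n\geq 1$ let $x_{n,1}<x_{n,2}<\dots<x_{n,n}=0$ be the $n$ (real, distinct) roots of the Eulerian polynomial $A_n(x)=\sum_{k=1}^n A(n,k)x^k$, and let $$\mu_n=\frac{1}{n}\sum_{k=1}^n \delta_{-x_{n,k}}.$$ Then, as $n\to\infty$, the sequence of probability measures $\mu_n$ converges weakly to a probability measure $\mu$ with support $[0,\infty)$. This measure $\mu$ is the distribution of $\exp(\pi Z)$, where $Z$ is a standard Cauchy random variable; equivalently, $\mu$ has density $$\frac{1}{t\left(\log^2 t+\pi^2\right)}\,1_{t>0}.$$
   Context: For $1\leq k\leq n$, $A(n,k)$ denotes the Eulerian number, i.e. the number of permutations of $\{1,\dots,n\}$ with exactly $k-1$ descents. It is a classical fact that $A_n(x)=\sum_{k=1}^n A(n,k)x^k$ has $n$ distinct real roots, all nonpositive, the largest being $0$. $\delta_a$ denotes the Dirac mass at $a$. *)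

(* Defs.v *)
From HB Require Import structures.
From mathcomp Require Import all_boot all_order all_algebra all_fingroup.
From mathcomp Require Import all_classical all_reals all_analysis.
From mathcomp Require Import measurable_realfun.

Set Implicit Arguments.
Unset Strict Implicit.
Unset Printing Implicit Defensive.

Import Order.TTheory GRing.Theory Num.Theory.
Import numFieldNormedType.Exports.

Local Open Scope classical_set_scope.
Local Open Scope ring_scope.

Definition descents (n : nat) (s : 'S_n) : {set 'I_n} :=
  [set i : 'I_n | [exists j : 'I_n, (j == i.+1 :> nat) && (s j < s i)%N]].

(* [k] is one more than the number of descents, so [eulerian_number n 0 = 0]. *)
Definition eulerian_number (n k : nat) : nat :=
  #|[set s : 'S_n | #|descents s|.+1 == k]%SET|.

Definition eulerian_poly (R : realType) (n : nat) : {poly R} :=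
  \sum_(1 <= k < n.+1) (eulerian_number n k)%:R *: 'X^k.

(* [y 1], ..., [y n] are the roots of the n-th Eulerian polynomial, listed in
   increasing order (for 1 <= n); the other values of [y] are irrelevant. *)
Record eulerian_roots (R : realType) (n : nat) (y : nat -> R) : Prop :=
  EulerianRoots {
    eulerian_roots_incr : forall j k : nat,
      (1 <= j)%N -> (j < k)%N -> (k <= n)%N -> y j < y k ;
    eulerian_rootsP : forall z : R,
      root (eulerian_poly R n) z <-> exists2 k : nat, (1 <= k <= n)%N & z = y k ;
    eulerian_roots_max : y n = 0
  }.

(* [msum _ n] sums over 0 <= k < n, hence the shift to [y 1], ..., [y n]. *)
Definition root_measure (R : realType) (y : nat -> R) (n : nat) :
    set R -> \bar R :=
  mscale (n%:R^-1)%:nng (msum (fun k : nat => dirac (- y k.+1)) n).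

HB.instance Definition _ (R : realType) (y : nat -> R) (n : nat) :=
  Measure.on (@root_measure R y n).

Lemma root_measure_setT (R : realType) (y : nat -> R) (n : nat) :
  @root_measure R y n.+1 setT = 1%E.
Proof.
rewrite /root_measure /mscale /= /msum.
rewrite (eq_bigr (fun=> 1%:E)) => [|k _]; last exact: diracT.
by rewrite sumEFin -EFinM sumr_const card_ord mulVf// pnatr_eq0.
Qed.

HB.instance Definition _ (R : realType) (y : nat -> R) (n : nat) :=
  Measure_isProbability.Build _ _ _ (@root_measure R y n.+1)
    (@root_measure_setT R y n).

Definition weakly_converges (R : realType)
    (mu_ : nat -> probability R R) (mu : probability R R) : Prop :=
  forall f : R -> R, continuous f -> (exists M : R, forall t, `|f t| <= M) ->
    (\int[mu_ n]_t (f t)%:E)%E @[n --> \oo] --> (\int[mu]_t (f t)%:E)%E.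

Definition measure_support (R : realType) (mu : probability R R) : set R :=
  [set t | forall U : set R, open U -> U t -> (0 < mu U)%E].

Definition has_density (R : realType) (mu : probability R R) (f : R -> R) :
    Prop :=
  [/\ measurable_fun setT f, forall t, 0 <= f t &
      forall A : set R, measurable A ->
        mu A = (\int[@lebesgue_measure R]_(t in A) (f t)%:E)%E].

Definition standard_cauchy_pdf (R : realType) (t : R) : R :=
  (pi * (1 + t ^+ 2))^-1.

Definition exp_pi (d : measure_display) (T : measurableType d) (R : realType)
    (Z : T -> R) : T -> R :=
  fun w => expR (pi * Z w).

Lemma measurable_exp_pi (d : measure_display) (T : measurableType d)
  (R : realType) (Z : {mfun T >-> R}) : measurable_fun setT (exp_pi Z).
Proof.
by apply: measurableT_comp => //; exact: measurable_funM.
Qed.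

HB.instance Definition _ (d : measure_display) (T : measurableType d)
    (R : realType) (Z : {mfun T >-> R}) :=
  isMeasurableFun.Build _ _ _ _ (exp_pi Z) (measurable_exp_pi Z).

(* Main.v *)
Require Import Defs.
From HB Require Import structures.
From mathcomp Require Import all_boot all_order all_algebra all_fingroup.
From mathcomp Require Import all_classical all_reals all_analysis.
From mathcomp Require Import measurable_realfun complex ring lra zify.

(* Let [f n = E n / (1 - 'X)^(n+1)] with [E n] the n-th Eulerian polynomial. Then [f n] is
   [x d/dx] applied [n] times to [1 / (1 - x)], so [f n (- e^u)] is the n-th derivative of
   [1 / (1 + e^u)], that is, the sum of [n! / (- p)^(n+1)] over [p = u + i pi (2m+1)] with
   [m] in [Z]. This expansion is the limit [N -> oo] of a finite identity, the decomposition
   of [f n (- x^N)] over the [N]-th roots of [- 1].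

   If [e^u] is the quantile [Q y] of the limit law, the two poles nearest the real line
   satisfy [- p = (pi / sin (pi y)) e^(+- i pi y)] and dominate the others, so that
   [f n (- Q y)] is close to [2 n! (sin (pi y) / pi)^(n+1) cos ((n+1) pi y)], which
   alternates in sign at the points [y = j / (n+1)]. The quantiles [Q (j / (n+1))] therefore
   separate the numbers [- x n k], whence the root measure of an interval is asymptotically
   at least its mass under the limit law. Such lower bounds suffice for weak convergence. *)

Set Implicit Arguments.
Unset Strict Implicit.
Unset Printing Implicit Defensive.

Import Order.TTheory GRing.Theory Num.Theory.
Import numFieldNormedType.Exports.

Local Open Scope ring_scope.

Local Notation Re := complex.Re.
Local Notation Im := complex.Im.
Local Notation normc := ComplexField.Normc.normc.

(** * Eulerian polynomials *)

Section descents.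
Implicit Types n : nat.

Lemma lift_perm_bij n (j : 'I_n.+1) :
  bijective (fun p : 'I_n.+1 * 'S_n => lift_perm p.1 j p.2).
Proof.
apply: inj_card_bij; last by rewrite card_prod !card_Sn card_ord factS.
move=> [i s] [i' t] /= eq_st; have ii' : i = i'.
  by apply: (@perm_inj _ (lift_perm i j s)); rewrite lift_perm_id eq_st lift_perm_id.
rewrite -ii' in eq_st *; congr pair; apply/permP => k; apply: (@lift_inj _ j).
by rewrite -!(lift_perm_lift i) eq_st.
Qed.

Lemma sum_lift_perm (V : nmodType) n (j : 'I_n.+1) (F : 'S_n.+1 -> V) :
  \sum_s F s = \sum_i \sum_(t : 'S_n) F (lift_perm i j t).
Proof. by rewrite pair_bigA (reindex _ (onW_bij _ (lift_perm_bij j))). Qed.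

Lemma card_lift n (i : 'I_n.+1) (A : {set 'I_n.+1}) :
  #|A| = ((i \in A) + #|[set k | lift i k \in A]|)%N.
Proof.
rewrite -!sum1_card big_mkcond (bigD1_ord i) //= [in RHS]big_mkcond /=.
by congr addn; apply: eq_bigr => k _; rewrite inE.
Qed.

Lemma descentsP n (s : 'S_n) (i : 'I_n) :
  reflect (exists2 j : 'I_n, j = i.+1 :> nat & (s j < s i)%N) (i \in descents s).
Proof.
rewrite inE; apply: (iffP existsP) => [[j /andP[/eqP ji sji]]|[j ji sji]].
  by exists j.
by exists j; rewrite ji eqxx.
Qed.

Lemma ord_max_notin_descents n (s : 'S_n.+1) : ord_max \notin descents s.
Proof. by apply/descentsP => -[j jE _]; have := ltn_ord j; rewrite jE ltnn. Qed.

Lemma card_descents_le n (s : 'S_n.+1) : (#|descents s| <= n)%N.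
Proof.
have /subset_leq_card : descents s \subset [set~ ord_max].
  by rewrite finset.subsetC finset.sub1set inE ord_max_notin_descents.
by rewrite cardsC1 card_ord.
Qed.

Lemma mem_descents_lift_max n (i : 'I_n.+1) (t : 'S_n) :
  (i \in descents (lift_perm i ord_max t)) = (i != ord_max).
Proof.
have [->|i_neq_max] := eqVneq i ord_max; first exact/negbTE/ord_max_notin_descents.
have i_ltn : (i < n)%N by rewrite ltn_neqAle i_neq_max -ltnS ltn_ord.
apply/descentsP; exists (lift i (Ordinal i_ltn)); first by rewrite /= /bump leqnn.
by rewrite lift_perm_lift lift_perm_id lift_max ltn_ord.
Qed.

Lemma lift_mem_descents_lift_max n (i : 'I_n.+1) (t : 'S_n) (k : 'I_n) :
  (lift i k \in descents (lift_perm i ord_max t)) =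
  (k \in descents t) && (k.+1 != i).
Proof.
apply/descentsP/andP => [[j]|[/descentsP[j jk tjk] ki]]; last first.
  exists (lift i j); last by rewrite !lift_perm_lift !lift_max.
  by rewrite /= /bump jk; move/eqP: ki; case: leqP; case: leqP => /=; lia.
rewrite lift_perm_lift lift_max; case: (unliftP i j) => [k' ->|-> _]; last first.
  by rewrite lift_perm_id /= ltnNge ltnW.
rewrite /= lift_perm_lift lift_max /bump => k'E tlt; split.
  apply/descentsP; exists k' => //.
  by move: k'E; case: leqP; case: leqP => /=; lia.
by apply/eqP => ki; move: k'E; case: leqP; case: leqP => /=; lia.
Qed.

Lemma card_descents_lift_max n (i : 'I_n.+1) (t : 'S_n) :
  #|descents (lift_perm i ord_max t)| =
  ((i != ord_max) + #|[set k in descents t | k.+1 != i]|)%N.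
Proof.
rewrite (card_lift i) mem_descents_lift_max; congr addn; apply: eq_card => k.
by rewrite [LHS]inE lift_mem_descents_lift_max [RHS]inE.
Qed.

Lemma card_descents_lift_max0 n (t : 'S_n.+1) :
  #|descents (lift_perm ord0 ord_max t)| = #|descents t|.+1.
Proof.
rewrite card_descents_lift_max add1n; congr _.+1; apply: eq_card => k.
by rewrite !inE andbT.
Qed.

Lemma card_descents_lift_maxS n (k : 'I_n.+1) (t : 'S_n.+1) :
  #|descents (lift_perm (lift ord0 k) ord_max t)| =
  (#|descents t| + (k \notin ord_max |: descents t))%N.
Proof.
have -> : #|descents t| = ((k \in descents t) + #|descents t :\ k|)%N by exact: cardsD1.
rewrite card_descents_lift_max addnAC; congr addn; last first.
  by apply: eq_card => k'; rewrite !inE /= /bump add1n eqSS andbC.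
rewrite -val_eqE /= /bump add1n eqSS in_setU1 negb_or.
have [->|] := eqVneq k ord_max.
  by rewrite eqxx (negbTE (ord_max_notin_descents t)).
by rewrite -val_eqE => /= /negbTE ->; case: (k \in descents t).
Qed.

End descents.

Fixpoint eulerian_rec (R : nzRingType) (n : nat) : {poly R} :=
  if n is m.+1 then
    'X * (1 - 'X) * (eulerian_rec R m)^`() + m.+1%:R *: ('X * eulerian_rec R m)
  else 1.

Lemma sum_exp_notin (R : nzRingType) n (x : R) m (A : {set 'I_n}) :
  \sum_i x ^+ (m + (i \notin A)) = x ^+ m *+ #|A| + x ^+ m.+1 *+ (n - #|A|).
Proof.
rewrite (bigID (mem A)) /=; congr (_ + _).
  by rewrite -sumr_const; apply: eq_bigr => i ->; rewrite addn0.
have -> : (n - #|A|)%N = #|~: A| by rewrite [RHS]cardsCs finset.setCK card_ord.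
rewrite -sumr_const.
by apply: eq_big => i; rewrite ?inE // => ->; rewrite addn1.
Qed.

Lemma sum_descents_lift_max (R : comNzRingType) n (t : 'S_n.+1) :
  \sum_i 'X^(#|descents (lift_perm i ord_max t)|.+1) =
  'X * (1 - 'X) * ('X^(#|descents t|.+1))^`()
   + n.+2%:R *: ('X * 'X^(#|descents t|.+1)) :> {poly R}.
Proof.
rewrite big_ord_recl card_descents_lift_max0.
under eq_bigr do rewrite card_descents_lift_maxS -addSn.
rewrite sum_exp_notin cardsU1 ord_max_notin_descents add1n subSS.
have := card_descents_le t; move: #|_| => d dn.
rewrite derivXn /= scaler_nat -['X^(d.+1) *+ _]mulr_natl -['X^(d.+2) *+ _]mulr_natl.
rewrite -['X^d *+ _]mulr_natl -[_ *+ n.+2]mulr_natl natrB // !exprS -!natr1.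
by ring.
Qed.

Lemma eulerian_rec_descents (R : comNzRingType) n :
  eulerian_rec R n.+1 = \sum_(s : 'S_n.+1) 'X^(#|descents s|.+1).
Proof.
elim: n => [|n IHn].
  rewrite (eq_bigr (fun=> 'X : {poly R})) => [|s _]; last first.
    by have := card_descents_le s; rewrite leqn0 => /eqP ->.
  by rewrite sumr_const card_Sn /= poly.derivE mulr0 add0r mulr1 scale1r.
rewrite [LHS]/= -/(eulerian_rec R n.+1) IHn.
rewrite [RHS](sum_lift_perm ord_max) exchange_big /=.
under [RHS]eq_bigr do rewrite sum_descents_lift_max.
rewrite big_split /= -mulr_sumr; congr (_ * _ + _); first by rewrite linear_sum.
by rewrite -scaler_sumr -mulr_sumr.
Qed.

Lemma eulerian_polyE (R : realType) n : eulerian_poly R n.+1 = eulerian_rec R n.+1.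
Proof.
rewrite /eulerian_poly eulerian_rec_descents.
rewrite [RHS](partition_big (fun s => inord #|descents s| : 'I_n.+1) xpredT) //=.
rewrite big_add1 big_mkord; apply: eq_bigr => k _.
rewrite (eq_bigr (fun=> 'X^(k.+1) : {poly R})) => [|s /eqP <-]; last first.
  by rewrite inordK // ltnS card_descents_le.
rewrite sumr_const scaler_nat; congr (_ *+ _); apply: eq_card => s.
by rewrite inE eqSS [RHS]unfold_in /= inordK ?ltnS ?card_descents_le.
Qed.

Lemma horner_eulerian_rec1 (R : comNzRingType) n : (eulerian_rec R n).[1] = n`!%:R.
Proof.
elim: n => [|n IHn] /=; first by rewrite hornerE.
by rewrite !(hornerE, hornerZ) /= IHn subrr mul0r add0r mulr1 factS natrM.
Qed.

Lemma ler_norm_horner_eulerian_rec (R : numDomainType) n (z c : R) :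
  1 <= c -> `|z| <= c -> `|(eulerian_rec R n).[z]| <= n`!%:R * c ^+ n.
Proof.
move=> c1 zc; case: n => [|n]; first by rewrite /= hornerE normr1 mul1r.
rewrite eulerian_rec_descents horner_sum (le_trans (ler_norm_sum _ _ _)) //.
rewrite -card_Sn mulr_natl -sumr_const; apply: ler_sum => s _.
rewrite hornerXn normrX (le_trans (lerXn2r _ _ _ zc)) ?nnegrE //.
  exact: le_trans ler01 c1.
by rewrite ler_weXn2l // ltnS card_descents_le.
Qed.

Lemma map_eulerian_rec (R S : nzRingType) (f : {rmorphism R -> S}) n :
  map_poly f (eulerian_rec R n) = eulerian_rec S n.
Proof.
elim: n => [|n IHn] /=; first by rewrite rmorph1.
rewrite rmorphD /= map_polyZ !rmorphM /= rmorphB rmorph1 /= !map_polyX.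
by rewrite -deriv_map IHn rmorph_nat.
Qed.

(* For [f n = eulerian_rec n / (1 - 'X)^(n+1)] this is [r f (n+1) (g) = 'X (f n (g))'],
   multiplied by [(1 - g)^(n+2)]. *)
Lemma eulerian_recS_comp (R : comNzRingType) n r (g : {poly R}) :
  'X * g^`() = r%:R * g ->
  r%:R * (eulerian_rec R n.+1 \Po g) =
  (1 - g) * 'X * (eulerian_rec R n \Po g)^`()
   - n.+1%:R * ('X * (1 - g)^`()) * (eulerian_rec R n \Po g).
Proof.
move=> gE; rewrite /= comp_polyD comp_polyZ !comp_polyM comp_polyB comp_polyC comp_polyX.
rewrite deriv_comp !poly.derivE scaler_nat -[_ *+ n.+1]mulr_natl.
move: (_ \Po _) (_ \Po _) => e e'.
transitivity (r%:R * g * ((1 - g) * e' + n.+1%:R * e)); first by ring.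
by rewrite -gE; ring.
Qed.

Section multisection.
Variables (R : idomainType) (N : nat) (xi : R).
Hypothesis xi_prim : N.*2.-primitive_root xi.

Let N_gt0 : (0 < N)%N.
Proof. by rewrite -double_gt0; exact: prim_order_gt0 xi_prim. Qed.

Lemma half_prim_expr : xi ^+ N = -1.
Proof.
have : (xi ^+ N) ^+ 2 == 1 by rewrite -exprM muln2 (prim_expr_order xi_prim).
rewrite sqrf_eq1 -(prim_order_dvd xi_prim) => /orP[|/eqP //].
by move=> /(dvdn_leq N_gt0); rewrite leqNgt -addnn -[ltnLHS]addn0 ltn_add2l N_gt0.
Qed.

Lemma odd_half_prim_expr m : (xi ^+ m.*2.+1) ^+ N = -1.
Proof. by rewrite exprAC half_prim_expr exprS -mul2n exprM sqrrN !expr1n mulr1. Qed.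

Lemma sum_odd_prim_expr j : (0 < j < N)%N -> \sum_(m < N) (xi ^+ m.*2.+1) ^+ j = 0.
Proof.
move=> /andP[j_gt0 j_ltN]; pose z := xi ^+ j.*2.
have zN : z ^+ N = 1.
  by rewrite -exprM -doubleMl doubleMr mulnC exprM (prim_expr_order xi_prim) expr1n.
have z_neq1 : z - 1 != 0.
  rewrite subr_eq0 -(prim_order_dvd xi_prim); apply: contraL j_ltN => N_dvd_j.
  by rewrite -leqNgt -leq_double dvdn_leq // double_gt0.
rewrite (eq_bigr (fun m : 'I_N => xi ^+ j * z ^+ m)) => [|m _]; last first.
  by rewrite /z -!exprM -exprD mulSn -doubleMl -doubleMl mulnC.
have /eqP : (z - 1) * \sum_(m < N) z ^+ m = 0 by rewrite -subrX1 zN subrr.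
by rewrite mulf_eq0 (negbTE z_neq1) -mulr_sumr => /eqP ->; rewrite mulr0.
Qed.

Lemma sum_geometric_odd_prim :
  \sum_(m < N) \sum_(j < N) (xi ^+ m.*2.+1 *: 'X) ^+ j = N%:R :> {poly R}.
Proof.
rewrite exchange_big /= (bigD1 (Ordinal N_gt0)) //= [X in _ + X]big1 => [|j j_neq0].
  by rewrite addr0 sumr_const card_ord.
under eq_bigr do rewrite exprZn.
by rewrite -scaler_suml sum_odd_prim_expr ?scale0r // ltn_ord andbT lt0n.
Qed.

(* Since [(1 - xi^(2m+1) 'X) \sum_(j < N) (xi^(2m+1) 'X)^j = 1 + 'X^N], this is the identity
   [N^(n+1) f n (- 'X^N) = \sum_m f n (xi^(2m+1) 'X)] cleared of denominators. *)
Lemma eulerian_rec_multisection n :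
  N%:R ^+ n.+1 * (eulerian_rec R n \Po (- 'X^N)) =
  \sum_(m < N) (eulerian_rec R n \Po (xi ^+ m.*2.+1 *: 'X)) *
    (\sum_(j < N) (xi ^+ m.*2.+1 *: 'X) ^+ j) ^+ n.+1.
Proof.
pose g m : {poly R} := xi ^+ m.*2.+1 *: 'X; pose L m := \sum_(j < N) g m ^+ j.
rewrite -[RHS]/(\sum_(m < N) (_ \Po g m) * L m ^+ _).
have gL m : (1 - g m) * L m = 1 - - 'X^N.
  by rewrite -opprB mulNr -subrX1 exprZn odd_half_prim_expr scaleN1r opprB.
elim: n => [|n IHn].
  rewrite comp_polyC mulr1 expr1 -sum_geometric_odd_prim.
  by apply: eq_bigr => m _; rewrite comp_polyC mul1r.
have gE m : 'X * (g m)^`() = 1%:R * g m.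
  by rewrite !poly.derivE alg_polyC mulrC mul_polyC mul1r.
have XNE : 'X * (- 'X^N : {poly R})^`() = N%:R * - 'X^N.
  rewrite !poly.derivE !mulrN mulrnAr -exprS prednK //.
  by rewrite mulr_natl.
have E_N := eulerian_recS_comp n XNE; have E_g m := eulerian_recS_comp n (gE m).
rewrite exprSr -mulrA E_N.
set A := eulerian_rec R n \Po - 'X^N in IHn *.
transitivity ((1 - - 'X^N) * 'X * (N%:R ^+ n.+1 * A)^`()
    - n.+1%:R * ('X * (1 - - 'X^N)^`()) * (N%:R ^+ n.+1 * A)).
  have -> : (N%:R ^+ n.+1 * A)^`() = N%:R ^+ n.+1 * A^`().
    by rewrite -natrX !mulr_natl derivMn.
  by ring.
rewrite IHn raddf_sum /= !mulr_sumr -sumrB; apply: eq_bigr => m _.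
rewrite -[X in _ = X * _]mul1r E_g derivM deriv_exp /= -(gL m) derivM.
by rewrite -mulr_natl !exprS; ring.
Qed.

End multisection.

Lemma eulerian_rec_partial_fractions (F : fieldType) N (xi x : F) n :
  N.*2.-primitive_root xi -> 1 + x ^+ N != 0 ->
  (eulerian_rec F n).[- x ^+ N] / (1 + x ^+ N) ^+ n.+1 =
  \sum_(m < N) (eulerian_rec F n).[xi ^+ m.*2.+1 * x]
               / (N%:R * (1 - xi ^+ m.*2.+1 * x)) ^+ n.+1.
Proof.
move=> xi_prim x_neq; pose z m := xi ^+ m.*2.+1 * x.
have N_neq0 : N%:R != 0 :> F.
  by apply: (prim_root_dvd_eq0 xi_prim); rewrite -muln2 dvdn_mulr.
have zL m : (1 - z m) * (\sum_(j < N) z m ^+ j) = 1 + x ^+ N.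
  rewrite -opprB mulNr -subrX1 exprMn (odd_half_prim_expr xi_prim) mulN1r opprB.
  by rewrite opprK.
have := congr1 (horner^~ x) (eulerian_rec_multisection xi_prim n).
rewrite horner_sum hornerM -natrX -polyC_natr hornerC horner_comp hornerN hornerXn natrX.
move=> multisection_x; apply: (mulfI (expf_neq0 n.+1 N_neq0)).
rewrite mulrA multisection_x mulr_suml mulr_sumr; apply: eq_bigr => m _.
rewrite hornerM horner_comp hornerZ hornerX -/(z m) horner_exp horner_sum.
under eq_bigr do rewrite horner_exp hornerZ hornerX -/(z m).
have := x_neq; rewrite -(zL m) mulf_eq0 negb_or => /andP[z_neq L_neq].
rewrite !exprMn mulrCA !invfM -mulrA; congr (_ * _).
by rewrite mulVKf ?expf_neq0 // [X in _ * X]mulrC mulrA divff ?mul1r ?expf_neq0.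
Qed.

(** * The complex exponential *)

Section complex_algebra.
Context {R : rcfType}.
Implicit Types p q : R[i].

Lemma ReD p q : Re (p + q) = Re p + Re q.
Proof. by case: p => a b; case: q. Qed.

Lemma ImD p q : Im (p + q) = Im p + Im q.
Proof. by case: p => a b; case: q. Qed.

Lemma Complex_mulrn (a b : R) n : Complex a b *+ n = Complex (a *+ n) (b *+ n).
Proof. by elim: n => // n IHn; rewrite mulrS IHn !mulrS. Qed.

Lemma Re_div_nat p n : Re (p / n%:R) = Re p / n%:R.
Proof.
rewrite -(rmorph_nat (real_complex R)) -fmorphV /=.
by case: p => a b /=; rewrite mulr0 subr0.
Qed.

Lemma Im_div_nat p n : Im (p / n%:R) = Im p / n%:R.
Proof.
rewrite -(rmorph_nat (real_complex R)) -fmorphV /=.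
by case: p => a b /=; rewrite mulr0 add0r.
Qed.

Lemma normc_ge0 p : 0 <= normc p.
Proof. by case: p => a b; exact: sqrtr_ge0. Qed.

Lemma normr_normc p : `|p| = (normc p)%:C%C.
Proof. by rewrite normc_def; case: p. Qed.

Lemma normc_real (a : R) : normc a%:C%C = `|a|.
Proof. by rewrite /= expr0n addr0 sqrtr_sqr. Qed.

Lemma normc_nat n : normc (n%:R : R[i]) = n%:R.
Proof. by rewrite -(rmorph_nat (real_complex R)) normc_real ger0_norm. Qed.

Lemma normcX p n : normc (p ^+ n) = normc p ^+ n.
Proof. by apply: complexI; rewrite rmorphXn -!normr_normc normrX. Qed.

Lemma ler_normc_sum I (r : seq I) (P : pred I) (F : I -> R[i]) :
  normc (\sum_(i <- r | P i) F i) <= \sum_(i <- r | P i) normc (F i).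
Proof.
rewrite -lecR -normr_normc (le_trans (ler_norm_sum _ _ _)) // rmorph_sum /=.
by under eq_bigr do rewrite normr_normc.
Qed.

Lemma ler_Re_normc p : `|Re p| <= normc p.
Proof. by rewrite -lecR -normr_normc normc_ge_Re. Qed.

End complex_algebra.

Section cexp.
Context {R : realType}.
Implicit Types (a u : R) (p q : R[i]).

Definition cexp p : R[i] := Complex (expR (Re p) * cos (Im p)) (expR (Re p) * sin (Im p)).

Lemma cexpD p q : cexp (p + q) = cexp p * cexp q.
Proof.
case: p q => a b [c d]; apply/eqP.
by rewrite eq_complex /= expRD cosD sinD; apply/andP; split; apply/eqP; ring.
Qed.

Lemma cexp_real a : cexp a%:C%C = (expR a)%:C%C.
Proof. by rewrite /cexp /= cos0 sin0 mulr1 mulr0. Qed.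

Lemma cexp0 : cexp 0 = 1.
Proof. by rewrite [cexp 0](cexp_real 0) expR0. Qed.

Lemma cexpMn p n : cexp (p *+ n) = cexp p ^+ n.
Proof. by elim: n => [|n IHn]; rewrite ?cexp0 // mulrS exprS cexpD IHn. Qed.

Lemma cexp_period p : cexp (p + Complex 0 (pi *+ 2)) = cexp p.
Proof. by rewrite cexpD /cexp /= expR0 !mul1r cos2pi sin2pi mulr1. Qed.

Lemma normc_cexp p : normc (cexp p) = expR (Re p).
Proof.
by rewrite /= !exprMn -mulrDr cos2Dsin2 mulr1 sqrtr_sqr ger0_norm // expR_ge0.
Qed.

Lemma sqr_normc_1Bcexp p :
  normc (1 - cexp p) ^+ 2 =
  (1 - expR (Re p)) ^+ 2 + 4 * expR (Re p) * sin (Im p / 2) ^+ 2.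
Proof.
have cosE : cos (Im p) = 1 - 2 * sin (Im p / 2) ^+ 2.
  have := cos2Dsin2 (Im p / 2); rewrite [in X in _ -> X = _](splitr (Im p)) cosD -!expr2.
  by lra.
have sin2E : sin (Im p) ^+ 2 = 1 - cos (Im p) ^+ 2.
  by rewrite -(cos2Dsin2 (Im p)) addrC addKr.
rewrite /= sqr_sqrtr ?addr_ge0 ?sqr_ge0 // sub0r sqrrN exprMn sin2E cosE.
by ring.
Qed.

Lemma cexp_primitive_root n : (0 < n)%N ->
  n.-primitive_root (cexp (Complex 0 (pi *+ 2 / n%:R))).
Proof.
move=> n_gt0; have nR_gt0 : 0 < n%:R :> R by rewrite ltr0n.
apply/andP; split=> //; apply/forallP => k; rewrite unity_rootE -cexpMn Complex_mulrn mul0rn.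
have [->|k_neq] := eqVneq k.+1 n.
  rewrite -[_ / _ *+ n]mulr_natr divfK ?(gt_eqF nR_gt0) // -[Complex _ _]add0r.
  by rewrite cexp_period cexp0 eqxx.
apply/eqP/negbTE; rewrite -subr_eq0 -oppr_eq0 opprB; apply/eqP => eq0.
have := sqr_normc_1Bcexp (Complex 0 ((pi *+ 2 / n%:R) *+ k.+1)).
rewrite eq0 ComplexField.Normc.normc0 /= expR0 subrr expr0n /= add0r mulr1 => /esym/eqP.
rewrite mulf_eq0 pnatr_eq0 /= sqrf_eq0; apply/negP; rewrite gt_eqF //.
apply: sin_gt0_pi; have pi0 := @pi_gt0 R.
have k_lt : k.+1%:R < n%:R :> R by rewrite ltr_nat ltn_neqAle k_neq ltn_ord.
have -> : (pi *+ 2 / n%:R) *+ k.+1 / 2 = pi * (k.+1%:R / n%:R) :> R.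
  by rewrite -[_ / _ *+ _]mulr_natr; field; rewrite gt_eqF.
by rewrite mulr_gt0 ?divr_gt0 //= gtr_pMr // ltr_pdivrMr // mul1r.
Qed.

End cexp.

Local Open Scope classical_set_scope.
Local Open Scope ring_scope.

Lemma is_derive1_direction (R : realType) (f : R -> R) (x v l : R) :
  is_derive x 1 f l -> is_derive x v f (v * l).
Proof.
move=> [/derivable1_diffP df <-]; apply: DeriveDef; first exact: diff_derivable.
rewrite !deriveE // -[v in LHS]mulr1 [v * 1]/(v *: 1).
by rewrite linearZ.
Qed.

Lemma cvg_natS_difference (R : realType) (f : R -> R) (x v l : R) : is_derive x 1 f l ->
  n.+1%:R * (f (v / n.+1%:R + x) - f x) @[n --> \oo] --> v * l.
Proof.
move=> /(@is_derive1_direction _ _ _ v)[df <-].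
have /cvgr_dnbhsP fh : h^-1 * (f (h * v + x) - f x) @[h --> 0^'] --> 'D_v f x := df.
have := fh _ (conj (fun n => lt0r_neq0 (harmonic_gt0 n)) cvg_harmonic).
by under eq_fun do rewrite /harmonic invrK [_ * v]mulrC.
Qed.

Lemma cvg_comp_div_natS (R : realType) (f : R -> R) (v : R) :
  {for 0, continuous f} -> f (v / n.+1%:R) @[n --> \oo] --> f 0.
Proof.
apply: cvg_comp.
have : v * n.+1%:R^-1 @[n --> \oo] --> v * 0.
  by apply: (@cvgM _ _ _ _ (fun=> v) harmonic); [exact: cvg_cst|exact: cvg_harmonic].
by rewrite mulr0.
Qed.

Lemma cvg_horner_div (K : numFieldType) (p : {poly K}) (z w : nat -> K) (a b : K) k :
  z n @[n --> \oo] --> a -> w n @[n --> \oo] --> b -> b != 0 ->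
  p.[z n] / w n ^+ k @[n --> \oo] --> p.[a] / b ^+ k.
Proof.
move=> za wb b_neq0; apply: cvgM.
  elim/poly_ind: p => [|p c IHp].
    by rewrite horner0; under eq_fun do rewrite horner0; exact: cvg_cst.
  rewrite hornerMXaddC; under eq_fun do rewrite hornerMXaddC.
  by apply: cvgD; [exact: cvgM|exact: cvg_cst].
apply: cvgV; first by rewrite expf_neq0.
elim: k => [|k IHk]; first by under eq_fun do rewrite expr0; exact: cvg_cst.
by rewrite exprS; under eq_fun do rewrite exprS; exact: cvgM.
Qed.

Section complex_limits.
Context {R : realType}.
Local Notation C := (R[i] : numFieldType).

Lemma cvg_real_complex (T : Type) (F : set_system T) {FF : Filter F} (f : T -> R) (l : R) :
  f x @[x --> F] --> l -> ((f x)%:C%C : C) @[x --> F] --> (l%:C%C : C).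
Proof.
move=> fl; apply/cvgrPdist_lt => -[e e']; rewrite ltcE /= => /andP[/eqP -> e_gt0].
near=> x; rewrite -rmorphB normr_normc normc_real ltcR.
by near: x; move/cvgrPdist_lt : fl; exact.
Unshelve. all: by end_near. Qed.

Lemma cvg_complex (T : Type) (F : set_system T) {FF : Filter F} (f : T -> C) (l : C) :
  Re (f x) @[x --> F] --> Re l -> Im (f x) @[x --> F] --> Im l -> f x @[x --> F] --> l.
Proof.
move=> fRe fIm; rewrite [l]complexE; under eq_fun => x do rewrite [f x]complexE.
apply: cvgD; first exact: cvg_real_complex.
by apply: cvgM; [exact: cvg_cst|exact: cvg_real_complex].
Qed.

Lemma cvg_Re (T : Type) (F : set_system T) {FF : Filter F} (f : T -> C) (l : C) :
  f x @[x --> F] --> l -> Re (f x) @[x --> F] --> Re l.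
Proof.
move=> fl; apply/cvgrPdist_lt => e e_gt0.
move/cvgrPdist_lt : fl => /(_ e%:C%C); rewrite ltcR => /(_ e_gt0).
apply: filterS => x; rewrite normr_normc ltcR; apply: le_lt_trans.
by have := ler_Re_normc (l - f x); rewrite ReD; case: (f x).
Qed.

End complex_limits.

(** * Poles of the derivatives of the logistic function *)

Section poles.
Context {R : realType}.
Local Notation C := (R[i] : numFieldType).
Implicit Types (u : R) (p : R[i]).

Definition pole u m : R[i] := Complex u (m.*2.+1%:R * pi).

Definition pole_term n N p : R[i] :=
  (eulerian_rec R[i] n).[cexp (p / N%:R)] / (N%:R * (1 - cexp (p / N%:R))) ^+ n.+1.

Lemma eulerian_rec_pole_sum n N u : (0 < N)%N ->
  ((eulerian_rec R n).[- expR u] / (1 + expR u) ^+ n.+1)%:C%C =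
  \sum_(m < N) pole_term n N (pole u m).
Proof.
move=> N_gt0; have N_neq0 : N%:R != 0 :> R[i] by rewrite pnatr_eq0 -lt0n.
pose xi : R[i] := cexp (Complex 0 (pi *+ 2 / N.*2%:R)).
have xi_prim : N.*2.-primitive_root xi by apply: cexp_primitive_root; rewrite double_gt0.
pose x : R[i] := cexp (u%:C%C / N%:R).
have xN : x ^+ N = (expR u)%:C%C by rewrite -cexpMn -[_ *+ N]mulr_natr divfK // cexp_real.
have poleE m : xi ^+ m.*2.+1 * x = cexp (pole u m / N%:R).
  rewrite -cexpMn -cexpD; congr cexp; apply/eqP; rewrite eq_complex Complex_mulrn mul0rn.
  rewrite !ReD !ImD !Re_div_nat !Im_div_nat /= mul0r add0r addr0 eqxx /=.
  rewrite -[_ / _ *+ _]mulr_natl -[N.*2]muln2 natrM -[pi *+ 2]mulr_natr; apply/eqP; field.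
  by rewrite pnatr_eq0 -lt0n.
have x_neq : 1 + x ^+ N != 0.
  rewrite xN -(rmorph1 (real_complex R)) -rmorphD /= -(rmorph0 (real_complex R)).
  by rewrite (inj_eq (@complexI R)) gt_eqF // addr_gt0 // expR_gt0.
transitivity ((eulerian_rec R[i] n).[- x ^+ N] / (1 + x ^+ N) ^+ n.+1).
  rewrite xN rmorphM fmorphV rmorphXn rmorphD rmorph1 /=.
  by rewrite -(map_eulerian_rec (real_complex R)) -rmorphN horner_map.
rewrite (eulerian_rec_partial_fractions n xi_prim x_neq).
by apply: eq_bigr => m _; rewrite /pole_term -poleE.
Qed.

Lemma cvg_natS_1Bcexp p : (k.+1%:R * (1 - cexp (p / k.+1%:R)) : C) @[k --> \oo] --> (- p : C).
Proof.
have cvg_expR := @cvg_comp_div_natS R expR (Re p) (@continuous_expR R 0).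
have cvg_cos := @cvg_comp_div_natS R cos (Im p) (@continuous_cos R 0).
have cvg_NexpR : k.+1%:R * (expR (Re p / k.+1%:R) - 1) @[k --> \oo] --> Re p.
  have := @cvg_natS_difference R expR 0 (Re p) _ (is_derive_expR 0).
  by rewrite expR0 mulr1; under eq_fun do rewrite addr0.
have cvg_Ncos : k.+1%:R * (cos (Im p / k.+1%:R) - 1) @[k --> \oo] --> (0 : R).
  have := @cvg_natS_difference R cos 0 (Im p) _ (is_derive_cos 0).
  by rewrite cos0 sin0 oppr0 mulr0; under eq_fun do rewrite addr0.
have cvg_Nsin : k.+1%:R * sin (Im p / k.+1%:R) @[k --> \oo] --> Im p.
  have := @cvg_natS_difference R sin 0 (Im p) _ (is_derive_sin 0).
  by rewrite cos0 sin0 mulr1; under eq_fun do rewrite addr0 subr0.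
rewrite expR0 in cvg_expR; rewrite cos0 in cvg_cos.
have natE k : k.+1%:R = k.+1%:R%:C%C :> R[i] by rewrite rmorph_nat.
have ReE k : Re (k.+1%:R * (1 - cexp (p / k.+1%:R))) =
    - (k.+1%:R * (expR (Re p / k.+1%:R) - 1) * cos (Im p / k.+1%:R))
    - k.+1%:R * (cos (Im p / k.+1%:R) - 1).
  by rewrite [X in X * (1 - cexp _)]natE [LHS]/= Re_div_nat Im_div_nat; ring.
have ImE k : Im (k.+1%:R * (1 - cexp (p / k.+1%:R))) =
    - (expR (Re p / k.+1%:R) * (k.+1%:R * sin (Im p / k.+1%:R))).
  by rewrite [X in X * (1 - cexp _)]natE [LHS]/= Re_div_nat Im_div_nat; ring.
apply: cvg_complex.
  under eq_fun do rewrite ReE.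
  have -> : Re (- p) = - (Re p * 1) - 0 by rewrite mulr1 subr0; case: (p).
  by apply: cvgB => //; apply: cvgN; exact: cvgM.
under eq_fun do rewrite ImE.
have -> : Im (- p) = - (1 * Im p) by rewrite mul1r; case: (p).
by apply: cvgN; exact: cvgM.
Qed.

Lemma cvg_cexp_div_natS p : (cexp (p / k.+1%:R) : C) @[k --> \oo] --> (cexp 0 : C).
Proof.
have cvg_expR := @cvg_comp_div_natS R expR (Re p) (@continuous_expR R 0).
have cvg_cos := @cvg_comp_div_natS R cos (Im p) (@continuous_cos R 0).
have cvg_sin := @cvg_comp_div_natS R sin (Im p) (@continuous_sin R 0).
apply: cvg_complex; under eq_fun do rewrite /= Re_div_nat Im_div_nat.
  exact: cvgM.
exact: cvgM.
Qed.

Lemma cvg_pole_term n p : p != 0 ->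
  (pole_term n k.+1 p : C) @[k --> \oo] --> (n`!%:R / (- p) ^+ n.+1 : C).
Proof.
move=> p_neq0; rewrite -horner_eulerian_rec1.
apply: cvg_horner_div; rewrite ?oppr_eq0 //; last exact: cvg_natS_1Bcexp.
by have := cvg_cexp_div_natS p; rewrite cexp0.
Qed.

End poles.

Section sin_chord.
Context {R : realType}.
Implicit Types t : R.

Local Open Scope convex_scope.

Lemma le_sin_pihalf t : 0 <= t <= 1 -> t <= sin (t * (pi / 2)).
Proof.
move=> /andP[t_ge0 t_le1]; pose f : R -> R^o := fun x => - sin x.
have pi_gt0 := @pi_gt0 R.
have cvg_f x : f @ x --> f x by apply: cvgN; exact: continuous_sin.
have derive_f : 'D_1 f = fun x => - cos x by apply/funext => x; exact: derive_val.
pose s : {i01 R} := Itv01 t_ge0 t_le1.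
have : f ((pi / 2 : R^o) <| s |> 0) <= f (pi / 2) <| s |> f 0.
  rewrite convC [leRHS]convC; apply: second_derivative_convex.
  - move=> x /andP[x_gt0 x_lt]; rewrite derive_f derive_val opprK ltW // sin_gt0_pi //.
    by rewrite x_gt0 (lt_trans x_lt) // ltr_pdivrMr // ltr_pMr // ltr1n.
  - exact: cvg_at_left_filter.
  - exact: cvg_at_right_filter.
  - by move=> x _; exact: ex_derive.
  - by move=> x _; rewrite derive_f; exact: ex_derive.
  - by rewrite divr_ge0 // ltW.
by rewrite !convRE /f sin0 sin_pihalf !mulr0 oppr0 mulr0 !addr0 mulrN1 lerN2.
Qed.

Lemma le_sin_pi t : 0 <= t <= 1 -> 2 * Num.min t (1 - t) <= sin (pi * t).
Proof.
wlog t_le : t / t <= 1 / 2 => [wlog_le|] /andP[t_ge0 t_le1].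
  have [/wlog_le|t_gt] := leP t (1 / 2); first by apply; rewrite t_ge0.
  have := wlog_le (1 - t); rewrite subKr minC mulrBr mulr1 sinB sinpi cospi.
  by rewrite mul0r sub0r mulN1r opprK; apply; lra.
have -> : pi * t = 2 * t * (pi / 2) by field.
by rewrite min_l ?le_sin_pihalf; lra.
Qed.

End sin_chord.

Section pole_remainder.
Context {R : realType}.
Implicit Types (u q : R) (p : R[i]).

Lemma sqr_normc_nat_1Bcexp p n :
  normc (n%:R * (1 - cexp (p / n%:R))) ^+ 2 =
  (n%:R * (1 - expR (Re p / n%:R))) ^+ 2
  + 4 * expR (Re p / n%:R) * (n%:R * sin (Im p / n%:R / 2)) ^+ 2.
Proof.
rewrite ComplexField.Normc.normcM exprMn normc_nat sqr_normc_1Bcexp.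
by rewrite Re_div_nat Im_div_nat; ring.
Qed.

Lemma normc_horner_eulerian_rec_le n p (c : R) : 1 <= c -> normc p <= c ->
  normc (eulerian_rec R[i] n).[p] <= n`!%:R * c ^+ n.
Proof.
move=> c_ge1 p_le; rewrite -lecR -normr_normc rmorphM rmorph_nat rmorphXn.
apply: ler_norm_horner_eulerian_rec; last by rewrite normr_normc lecR.
by rewrite -(rmorph1 (real_complex R)) lecR.
Qed.

Lemma sum_inv_odd_sqr M : \sum_(m < M) ((m.*2.+3)%:R ^+ 2)^-1 <= 1 / 4 :> R.
Proof.
suff : \sum_(m < M) ((m.*2.+3)%:R ^+ 2)^-1 <= 1 / 4 - (4 * M.+1%:R)^-1 :> R.
  by move=> /le_trans; apply; rewrite gerBl invr_ge0 mulr_ge0.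
elim: M => [|M IHM]; first by rewrite big_ord0 mulr1 div1r subrr.
rewrite big_ord_recr /= (le_trans (lerD IHM (lexx _))) //.
have -> : (M.*2.+3)%:R = 2 * M%:R + 3 :> R by rewrite -addn3 natrD -mul2n natrM.
have -> : M.+1%:R = M%:R + 1 :> R by rewrite natr1.
have -> : M.+2%:R = M%:R + 2 :> R by rewrite -addn2 natrD.
have : 0 <= M%:R :> R by []; move: M%:R => x x_ge0.
have -> : (4 * (x + 2))^-1 = (4 * (x + 1))^-1 - (4 * (x + 1) * (x + 2))^-1.
  by field; apply/andP; split; apply: lt0r_neq0; lra.
have : ((2 * x + 3) ^+ 2)^-1 <= (4 * (x + 1) * (x + 2))^-1; last by lra.
by rewrite lef_pV2 ?posrE ?exprn_gt0 ?mulr_gt0 //; [nra|lra|lra|lra].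
Qed.

Lemma le_nat_sin_pole u M (m : 'I_M) :
  Num.min (m.*2.+3)%:R ((rev_ord m).*2.+3)%:R <=
  M.+2%:R * sin (Im (pole u m.+1) / M.+2%:R / 2).
Proof.
set N : R := M.+2%:R; have N_gt0 : 0 < N by rewrite ltr0n.
pose t : R := (m.*2.+3)%:R / (2 * N).
have revE : (1 - t) * (2 * N) = ((rev_ord m).*2.+3)%:R.
  rewrite mulrBl divfK ?gt_eqF ?mulr_gt0 // mul1r.
  apply/eqP; rewrite subr_eq -natrM -natrD eqr_nat /= -!mul2n.
  by have := ltn_ord m; lia.
have tE : t * (2 * N) = (m.*2.+3)%:R by rewrite divfK // gt_eqF ?mulr_gt0.
have N2_gt0 : 0 < 2 * N by rewrite mulr_gt0.
have t_itv : 0 <= t <= 1.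
  apply/andP; split; first by rewrite -(pmulr_lge0 _ N2_gt0) tE.
  by rewrite -subr_ge0 -(pmulr_lge0 _ N2_gt0) revE.
have -> : Im (pole u m.+1) / N / 2 = pi * t by rewrite /t /= doubleS; field; rewrite gt_eqF.
rewrite -tE -revE -minr_pMl ?(ltW N2_gt0) // mulrC [2 * N]mulrC -mulrA.
by rewrite ler_wpM2l ?le_sin_pi ?(ltW N_gt0).
Qed.

Lemma normc_pole_term_le n u M (m : 'I_M) q : let w := expR (u / M.+2%:R) in
  1 / 4 <= w -> w ^+ n.+1 <= 2 ->
  0 < q -> q ^+ 2 <= (M.+2%:R * (1 - w)) ^+ 2 + 36 * w ->
  normc (pole_term n.+1 M.+2 (pole u m.+1)) <=
  2 * (n.+1)`!%:R / q ^+ n *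
    (((m.*2.+3)%:R ^+ 2)^-1 + (((rev_ord m).*2.+3)%:R ^+ 2)^-1).
Proof.
move=> w w_ge w_le q_gt0 q_le; rewrite /pole_term; set z := cexp _.
set D := normc (M.+2%:R * (1 - z)).
set b : R := Num.min (m.*2.+3)%:R ((rev_ord m).*2.+3)%:R.
have b_ge3 : 3 <= b by rewrite le_min !ler_nat.
have b2_ge9 : 9 <= b ^+ 2 by nra.
have := sqr_normc_nat_1Bcexp (pole u m.+1) M.+2; rewrite -/z -/D -/w.
set A := (_ * (1 - w)) ^+ 2 in q_le *; set S := (_ * sin _) ^+ 2 => DE.
have A_ge0 : 0 <= A := sqr_ge0 _.
have bS : b ^+ 2 <= S.
  by have := le_nat_sin_pole u m; rewrite -/b => ?; rewrite ler_pXn2r ?nnegrE //; lra.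
have qD2 : q ^+ 2 <= D ^+ 2 by rewrite DE; nra.
have bD2 : b ^+ 2 <= D ^+ 2 by rewrite DE; nra.
have D_ge0 : 0 <= D := normc_ge0 _.
have qD : q <= D by rewrite -(ler_pXn2r (ltn0Sn 1)) ?nnegrE // ltW.
have E_le : normc (eulerian_rec R[i] n.+1).[z] <= 2 * (n.+1)`!%:R.
  apply: (@le_trans _ _ ((n.+1)`!%:R * Num.max 1 w ^+ n.+1)).
    apply: normc_horner_eulerian_rec_le; first by rewrite le_max lexx.
    by rewrite normc_cexp Re_div_nat le_max lexx orbT.
  rewrite mulrC ler_wpM2r //; case: (leP 1 w) => // _.
  by rewrite expr1n ler1n.
rewrite ComplexField.Normc.normcM ComplexField.Normc.normcV normcX -/D.
rewrite -addn2 exprD invfM mulrA; apply: ler_pM.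
- by rewrite mulr_ge0 ?invr_ge0 ?exprn_ge0 ?normc_ge0.
- by rewrite invr_ge0 exprn_ge0.
- apply: ler_pM => //; rewrite ?normc_ge0 ?invr_ge0 ?exprn_ge0 //.
  rewrite lef_pV2 ?posrE ?exprn_gt0 ?(lt_le_trans q_gt0 qD) //.
  by rewrite lerXn2r ?nnegrE ?(ltW q_gt0).
apply: (@le_trans _ _ (b ^+ 2)^-1).
  by rewrite lef_pV2 ?posrE ?exprn_gt0 ?(lt_le_trans q_gt0 qD) //; lra.
by rewrite /b minEle; case: ifP => _; rewrite ?lerDl ?lerDr invr_ge0 sqr_ge0.
Qed.

Lemma normc_sum_pole_term_le n u M q : let w := expR (u / M.+2%:R) in
  1 / 4 <= w -> w ^+ n.+1 <= 2 ->
  0 < q -> q ^+ 2 <= (M.+2%:R * (1 - w)) ^+ 2 + 36 * w ->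
  normc (\sum_(m < M) pole_term n.+1 M.+2 (pole u m.+1)) <= (n.+1)`!%:R / q ^+ n.
Proof.
move=> w w_ge w_le q_gt0 q_le; apply: le_trans (ler_normc_sum _ _ _) _.
apply: le_trans (ler_sum _ (fun m _ => normc_pole_term_le m w_ge w_le q_gt0 q_le)) _.
have rev_sum : \sum_(m < M) (((rev_ord m).*2.+3)%:R ^+ 2)^-1 =
    \sum_(m < M) ((m.*2.+3)%:R ^+ 2)^-1 :> R.
  by rewrite [RHS](reindex_inj rev_ord_inj).
rewrite -mulr_sumr big_split rev_sum /=.
have := sum_inv_odd_sqr M; set S := \sum_(m < M) _ => S_le.
have -> : 2 * (n.+1)`!%:R / q ^+ n * (S + S) = (n.+1)`!%:R / q ^+ n * (4 * S) by ring.
by rewrite ler_piMr ?divr_ge0 ?exprn_ge0 ?(ltW q_gt0) //; lra.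
Qed.

End pole_remainder.

Section pole_estimate.
Context {R : realType}.
Implicit Types (u q : R).

Lemma pole_neq0 u m : pole u m != 0.
Proof. by rewrite eq_complex /= mulf_eq0 pnatr_eq0 [pi == 0]gt_eqF ?pi_gt0 ?andbF. Qed.

Lemma pole_term_last n u k :
  pole_term n k.+1 (pole u k) = pole_term n k.+1 (conjc (pole u 0)).
Proof.
rewrite /pole_term; suff -> : pole u k / k.+1%:R =
    conjc (pole u 0) / k.+1%:R + Complex 0 (pi *+ 2) by rewrite cexp_period.
apply/eqP; rewrite eq_complex ReD ImD !Re_div_nat !Im_div_nat /= addr0 eqxx /=.
rewrite double0 mul1r -[k.*2.+1%:R]natr1 -muln2 natrM -[pi *+ 2]mulr_natr -natr1.
by apply/eqP; field; rewrite nat1r.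
Qed.

Lemma Re_pole_limit_conj n u :
  Re (n`!%:R / (- conjc (pole u 0)) ^+ n.+1) = Re (n`!%:R / (- pole u 0) ^+ n.+1).
Proof.
have ReJ (z : R[i]) : Re z = Re (conjc z) by case: z.
by rewrite [RHS]ReJ rmorphM fmorphV rmorphXn rmorphN rmorph_nat.
Qed.

(* The remaining poles lie at distance at least [sqrt (u^2 + 9 pi^2)] from [0]; what is lost
   in [sin (pi t) >= 2 t] replaces [9 pi^2] by [36]. *)
Lemma near_normc_sum_pole_term_le n u q : 0 < q -> q ^+ 2 < u ^+ 2 + 36 ->
  \forall k \near \oo,
    normc (\sum_(m < k) pole_term n.+1 k.+2 (pole u m.+1)) <= (n.+1)`!%:R / q ^+ n.
Proof.
move=> q_gt0 q_lt; pose w k := expR (u / k.+2%:R).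
have cvg_w : w k @[k --> \oo] --> (1 : R).
  have := @cvg_comp_div_natS R expR u (@continuous_expR R 0).
  by rewrite expR0 -(cvg_shiftS (fun k => expR (u / k.+1%:R))).
have cvg_wX : w k ^+ n.+1 @[k --> \oo] --> (1 : R).
  by have := cvg_comp _ _ cvg_w (@exprn_continuous R n.+1 1); rewrite expr1n.
have cvg_Nw : k.+2%:R * (1 - w k) @[k --> \oo] --> - u.
  have wE k : k.+2%:R * (1 - w k) = - (k.+2%:R * (expR (u / k.+2%:R + 0) - 1)).
    by rewrite addr0 -mulrN opprB.
  under eq_fun do rewrite wE; apply: cvgN.
  have := @cvg_natS_difference R expR 0 u _ (is_derive_expR 0).
  by rewrite expR0 mulr1 -(cvg_shiftS (fun k => k.+1%:R * (expR (u / k.+1%:R + 0) - 1))).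
have cvg_q : (k.+2%:R * (1 - w k)) ^+ 2 + 36 * w k @[k --> \oo] --> u ^+ 2 + 36.
  have -> : u ^+ 2 + 36 = (- u) ^+ 2 + 36 * 1 by rewrite sqrrN mulr1.
  apply: cvgD; last by apply: cvgM => //; exact: cvg_cst.
  exact: (cvg_comp _ _ cvg_Nw (@exprn_continuous R 2 (- u))).
near=> k; apply: normc_sum_pole_term_le => //; rewrite -/(w k).
- by near: k; apply: (cvgr_ge (1 : R)) => //; lra.
- by near: k; apply: (cvgr_le (1 : R)) => //; lra.
- by near: k; apply: (cvgr_ge (u ^+ 2 + 36)).
Unshelve. all: by end_near. Qed.

Lemma eulerian_rec_pole_estimate n u q : 0 < q -> q ^+ 2 < u ^+ 2 + 36 ->
  `|(eulerian_rec R n.+1).[- expR u] / (1 + expR u) ^+ n.+2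
    - 2 * Re ((n.+1)`!%:R / (- pole u 0) ^+ n.+2)| <= (n.+1)`!%:R / q ^+ n.
Proof.
move=> q_gt0 q_lt; set S := _ / (1 + _) ^+ _; set c := Re _.
pose T k m := Re (pole_term n.+1 k.+2 (pole u m)).
have cvg_Re_term (p : R[i]) : p != 0 -> Re (pole_term n.+1 k.+2 p) @[k --> \oo] -->
    Re ((n.+1)`!%:R / (- p) ^+ n.+2).
  move=> /(@cvg_pole_term R n.+1) /cvg_Re.
  by rewrite -(cvg_shiftS (fun k => Re (pole_term n.+1 k.+1 p))).
have cvg_first : T k 0 @[k --> \oo] --> c := cvg_Re_term _ (pole_neq0 u 0).
have cvg_last : T k k.+1 @[k --> \oo] --> c.
  under eq_fun do rewrite /T pole_term_last.
  by rewrite /c -Re_pole_limit_conj; apply: cvg_Re_term; rewrite conjc_eq0 pole_neq0.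
rewrite mulr_natl mulr2n.
apply: (cvgr_to_le (cvg_norm (cvgB (cvg_cst S) (cvgD cvg_first cvg_last)))).
near=> k; rewrite -[X in `|X|]/(S - (T k 0 + T k k.+1)).
have -> : S - (T k 0 + T k k.+1) = Re (\sum_(m < k) pole_term n.+1 k.+2 (pole u m.+1)).
  have := congr1 (@complex.Re R) (eulerian_rec_pole_sum n.+1 u (ltn0Sn k.+1)).
  by rewrite big_ord_recl big_ord_recr !ReD [LHS]/= -/S => ->; rewrite addrCA addrK.
apply: le_trans (ler_Re_normc _) _.
by near: k; exact: near_normc_sum_pole_term_le.
Unshelve. all: by end_near. Qed.

End pole_estimate.

(** * Sign alternation at the quantiles *)

Section eulerian_quantile.
Context {R : realType}.
Implicit Types (s t x : R).

Definition eulerian_cdf t : R := 1 / 2 + atan (ln t / pi) / pi.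

Definition eulerian_quantile x : R := expR (pi * tan (pi * (x - 1 / 2))).

Let pi_gt0 : 0 < pi :> R := pi_gt0 R.

Lemma eulerian_cdf_itv t : 0 < eulerian_cdf t < 1.
Proof.
have [atan_lt atan_gt] := (atan_ltpi2 (ln t / pi), atan_gtNpi2 (ln t / pi)).
have lt_half : atan (ln t / pi) / pi < 1 / 2 by rewrite ltr_pdivrMr //; lra.
have gt_half : - (1 / 2) < atan (ln t / pi) / pi by rewrite ltr_pdivlMr //; lra.
by apply/andP; split; rewrite /eulerian_cdf; lra.
Qed.

Lemma eulerian_cdfK t : 0 < t -> eulerian_quantile (eulerian_cdf t) = t.
Proof.
move=> t_gt0; rewrite /eulerian_quantile /eulerian_cdf addrAC subrr add0r.
by rewrite [pi * (atan _ / _)]mulrC divfK ?gt_eqF // atanK [pi * _]mulrC divfK ?gt_eqF // lnK.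
Qed.

Lemma lt_eulerian_cdf s t : 0 < s -> s < t -> eulerian_cdf s < eulerian_cdf t.
Proof.
move=> s_gt0 st; rewrite ltrD2l ltr_pM2r ?invr_gt0 // lt_atan //.
by rewrite ltr_pM2r ?invr_gt0 // ltr_ln // posrE (lt_trans s_gt0).
Qed.

Lemma lt_eulerian_quantile x y :
  0 < x -> x < y -> y < 1 -> eulerian_quantile x < eulerian_quantile y.
Proof.
have tan_dom (z : R) : 0 < z -> z < 1 -> pi * (z - 1 / 2) \in `](- (pi / 2)), (pi / 2)[.
  move=> z_gt0 z_lt1; have : 0 < pi * z by rewrite mulr_gt0.
  have : pi * z < pi * 1 by rewrite ltr_pM2l.
  rewrite in_itv /= => ? ?; apply/andP; split; lra.
move=> x_gt0 xy y_lt1; rewrite ltr_expR ltr_pM2l // ltr_tan.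
- by rewrite ltr_pM2l // ltrD2r.
- by rewrite tan_dom // (lt_trans xy).
- by rewrite tan_dom // (lt_trans x_gt0).
Qed.

Lemma le_eulerian_quantile x y :
  0 < x -> x <= y -> y < 1 -> eulerian_quantile x <= eulerian_quantile y.
Proof.
move=> x_gt0; rewrite le_eqVlt => /predU1P[-> //|xy] y_lt1.
exact/ltW/lt_eulerian_quantile.
Qed.

(* [ln (eulerian_quantile x) = - pi cot (pi x)], so the pole above it has argument
   [pi - pi x] and modulus [pi / sin (pi x)]. *)
Lemma invN_pole_quantile x : 0 < x < 1 ->
  (- pole (pi * tan (pi * (x - 1 / 2))) 0)^-1 =
  (sin (pi * x) / pi)%:C%C * cexp (Complex 0 (pi * x)).
Proof.
move=> /andP[x_gt0 x_lt1].
have sin_gt0 : 0 < sin (pi * x) by rewrite sin_gt0_pi // mulr_gt0 //= gtr_pMr.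
have -> : tan (pi * (x - 1 / 2)) = - (cos (pi * x) / sin (pi * x)).
  have -> : pi * (x - 1 / 2) = pi * x - pi / 2 by field.
  by rewrite /tan sinBpihalf cosBpihalf mulNr.
apply: mulr1_eq; apply/eqP; rewrite eq_complex /= double0 expR0 !mul1r.
have := cos2Dsin2 (pi * x); set c := cos _; set d := sin _ in sin_gt0 * => cd.
have d_neq0 : d != 0 by rewrite gt_eqF.
move: (@pi R) (lt0r_neq0 pi_gt0) => p p_neq0.
by apply/andP; split; apply/eqP; [rewrite -cd|]; field; rewrite d_neq0 p_neq0.
Qed.

Lemma Re_pole_quantile n m x : 0 < x < 1 ->
  Re (m%:R / (- pole (pi * tan (pi * (x - 1 / 2))) 0) ^+ n) =
  m%:R * (sin (pi * x) / pi) ^+ n * cos (n%:R * (pi * x)).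
Proof.
move=> x01; rewrite -exprVn invN_pole_quantile // exprMn -cexpMn (Complex_mulrn 0) mul0rn.
rewrite -(rmorph_nat (real_complex R)) -rmorphXn [X in Re X]mulrA -rmorphM /=.
by rewrite expR0 mul1r mul0r subr0 [n%:R * _]mulr_natl.
Qed.

Lemma sqr_ln_quantile x : 0 < x < 1 ->
  (pi * tan (pi * (x - 1 / 2))) ^+ 2 + pi ^+ 2 = (pi / sin (pi * x)) ^+ 2.
Proof.
move=> /andP[x_gt0 x_lt1].
have sin_gt0 : 0 < sin (pi * x) by rewrite sin_gt0_pi // mulr_gt0 //= gtr_pMr.
have -> : pi * (x - 1 / 2) = pi * x - pi / 2 by field.
rewrite /tan sinBpihalf cosBpihalf; have := cos2Dsin2 (pi * x).
set c := cos _; set d := sin _ in sin_gt0 * => cd.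
have d_neq0 : d != 0 by rewrite gt_eqF.
transitivity (pi ^+ 2 * (c ^+ 2 + d ^+ 2) / d ^+ 2).
  by move: (@pi R) => p; field.
by rewrite cd mulr1 expr_div_n.
Qed.

End eulerian_quantile.

Section eulerian_sign.
Context {R : realType}.
Implicit Types (a b d x : R).

Let pi_gt0 : 0 < pi :> R := pi_gt0 R.

Lemma cos_natpi j : cos (j%:R * pi) = (-1) ^+ j :> R.
Proof.
elim: j => [|j IHj]; first by rewrite mul0r cos0.
by rewrite -natr1 mulrDl mul1r cosDpi IHj exprS mulN1r.
Qed.

(* The hypothesis compares the two nearest poles, at distance [rho = pi / sin (pi x)], with
   the bound on all the others at distance [q], where [q^2 = rho^2 + pi^2]. *)
Lemma eulerian_rec_quantile_sign n j x : 0 < x < 1 -> n.+2%:R * x = j%:R ->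
  (pi / sin (pi * x)) ^+ 4 < (1 + sin (pi * x) ^+ 2) ^+ n ->
  0 < (-1) ^+ j * (eulerian_rec R n.+1).[- eulerian_quantile x].
Proof.
move=> x01 xj; have /andP[x_gt0 x_lt1] := x01.
have sin_gt0 : 0 < sin (pi * x) by rewrite sin_gt0_pi // mulr_gt0 //= gtr_pMr.
set d := sin (pi * x) in sin_gt0 *; set rho := pi / d => rho_lt.
have rho_gt0 : 0 < rho by rewrite divr_gt0.
pose q : R := Num.sqrt (rho ^+ 2 + pi ^+ 2).
have q2 : q ^+ 2 = rho ^+ 2 * (1 + d ^+ 2).
  by rewrite sqr_sqrtr ?addr_ge0 ?sqr_ge0 // /rho; field; rewrite gt_eqF.
have q_gt0 : 0 < q by rewrite sqrtr_gt0 addr_gt0 // exprn_gt0.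
have rho_q : rho ^+ n.+2 < q ^+ n.
  rewrite -(ltr_pXn2r (ltn0Sn 1)) ?nnegrE ?exprn_ge0 ?(ltW rho_gt0) ?(ltW q_gt0) //.
  have -> : (rho ^+ n.+2) ^+ 2 = (rho ^+ 2) ^+ n * rho ^+ 4.
    by rewrite -!exprM -exprD; congr (_ ^+ _); lia.
  have -> : (q ^+ n) ^+ 2 = (rho ^+ 2) ^+ n * (1 + d ^+ 2) ^+ n.
    by rewrite -exprMn -q2 exprAC.
  by rewrite ltr_pM2l ?exprn_gt0.
pose u : R := pi * tan (pi * (x - 1 / 2)).
have q_lt : q ^+ 2 < u ^+ 2 + 36.
  rewrite sqr_sqrtr ?addr_ge0 ?sqr_ge0 // /rho -sqr_ln_quantile // -addrA ltrD2l.
  by have := pi_gt0; have := pihalf_lt2 R; nra.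
have := eulerian_rec_pole_estimate n q_gt0 q_lt.
rewrite Re_pole_quantile // [n.+2%:R * _]mulrCA xj [pi * j%:R]mulrC cos_natpi.
rewrite -[d / pi]invf_div -/rho exprVn.
set E := (eulerian_rec R n.+1).[_]; set y := 1 + expR u => E_close.
have y_gt0 : 0 < y ^+ n.+2 by rewrite exprn_gt0 // addr_gt0 // expR_gt0.
have F_gt0 : 0 < (n.+1)`!%:R :> R by rewrite ltr0n fact_gt0.
have main_gt : (n.+1)`!%:R / q ^+ n < (n.+1)`!%:R / rho ^+ n.+2.
  by rewrite ltr_pM2l // ltf_pV2 ?posrE ?exprn_gt0.
suff : 0 < (-1) ^+ j * (E / y ^+ n.+2) by rewrite mulrA pmulr_lgt0 ?invr_gt0.
move: E_close main_gt; set S := E / y ^+ n.+2.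
rewrite -(signr_odd _ j) ler_norml => /andP[S_ge S_le] main_gt.
by move: S_ge S_le; case: (odd j); rewrite ?expr1 ?expr0 => S_ge S_le; lra.
Qed.

Lemma near_lt_exp a x : 1 < x -> \forall n \near \oo, a < x ^+ n.
Proof.
move=> x_gt1; have x_gt0 : 0 < x := lt_trans ltr01 x_gt1.
have a1_gt0 : 0 < `|a| + 1 by rewrite ltr_wpDl.
have : geometric 1 x^-1 n @[n --> \oo] --> (0 : R).
  by apply: cvg_geometric; rewrite ger0_norm ?invr_ge0 ?(ltW x_gt0) // invf_lt1.
move=> /(cvgr_lt (0 : R)) /(_ (`|a| + 1)^-1); rewrite invr_gt0 => /(_ a1_gt0).
apply: filterS => n; rewrite /= mul1r exprVn ltf_pV2 ?posrE ?exprn_gt0 //.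
by apply: lt_trans; rewrite (le_lt_trans (ler_norm a)) // ltrDl.
Qed.

Lemma near_eulerian_rec_quantile_sign a b : 0 < a -> b < 1 ->
  \forall n \near \oo, forall j, a <= j%:R / n.+1%:R <= b ->
    0 < (-1) ^+ j * (eulerian_rec R n).[- eulerian_quantile (j%:R / n.+1%:R)].
Proof.
move=> a_gt0 b_lt1; pose d := 2 * Num.min a (1 - b).
have d_gt0 : 0 < d by rewrite mulr_gt0 // lt_min a_gt0 subr_gt0.
have [n0 _ n0P] : \forall n \near \oo, (pi / d) ^+ 4 < (1 + d ^+ 2) ^+ n.
  by apply: near_lt_exp; rewrite ltrDl exprn_gt0.
exists n0.+1 => // -[//|n] /= n0n j; set x := j%:R / _ => /andP[ax xb].
have x01 : 0 < x < 1 by rewrite (lt_le_trans a_gt0) // (le_lt_trans xb).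
have /andP[x_gt0 x_lt1] := x01.
have d_le : d <= sin (pi * x).
  apply: le_trans (le_sin_pi _); last by rewrite !ltW.
  by rewrite ler_pM2l // le_min !ge_min ax lerD2l lerN2 xb orbT.
have sin_gt0 := lt_le_trans d_gt0 d_le.
apply: eulerian_rec_quantile_sign => //; first by rewrite mulrC divfK // pnatr_eq0.
apply: le_lt_trans (lt_le_trans (n0P n n0n) _).
  rewrite lerXn2r ?nnegrE ?divr_ge0 ?(ltW pi_gt0) ?(ltW sin_gt0) ?(ltW d_gt0) //.
  by rewrite ler_pM2l // lef_pV2 ?posrE.
rewrite lerXn2r ?nnegrE ?addr_ge0 ?sqr_ge0 // lerD2l.
by rewrite lerXn2r ?nnegrE ?(ltW sin_gt0) ?(ltW d_gt0).
Qed.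

Lemma near_eulerian_rec_root_between a b : 0 < a -> b < 1 ->
  \forall n \near \oo, forall j, a <= j%:R / n.+1%:R -> j.+1%:R / n.+1%:R <= b ->
    exists2 z, root (eulerian_rec R n) z &
      eulerian_quantile (j%:R / n.+1%:R) < - z < eulerian_quantile (j.+1%:R / n.+1%:R).
Proof.
move=> a_gt0 b_lt1; apply: filterS (near_eulerian_rec_quantile_sign a_gt0 b_lt1) => n sgn j.
set x := j%:R / _; set y := j.+1%:R / _ => ax yb.
have xy : x < y by rewrite ltr_pM2r ?invr_gt0 ?ltr0n // ltr_nat.
have quantile_lt : eulerian_quantile x < eulerian_quantile y.
  by rewrite lt_eulerian_quantile ?(lt_le_trans a_gt0) ?(le_lt_trans yb).
have sgn_x : 0 < (-1) ^+ j * (eulerian_rec R n).[- eulerian_quantile x].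
  by apply: sgn; rewrite ax (le_trans (ltW xy)).
have sgn_y : 0 < (-1) ^+ j.+1 * (eulerian_rec R n).[- eulerian_quantile y].
  by apply: sgn; rewrite yb (le_trans ax) // ltW.
have [||z] := @polyrcf.poly_ivtoo R (eulerian_rec R n)
    (- eulerian_quantile y) (- eulerian_quantile x); first by rewrite lerN2 ltW.
  move: sgn_x sgn_y; rewrite exprS -signr_odd; move: (_.[_]) (_.[_]) => Ex Ey.
  by case: (odd j); rewrite ?expr1 ?expr0 => ? ?; nra.
by rewrite in_itv /= -{1}[z]opprK -{2}[z]opprK !ltrN2 andbC => z_itv rootz; exists z.
Qed.

End eulerian_sign.

Section root_count.
Context {R : realType}.
Implicit Types (s t e : R).

Lemma card_separated_ge n (y : 'I_n -> R) (v : nat -> R) i d s t :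
  (forall j, (i <= j < i + d)%N -> exists k, v j < y k < v j.+1) ->
  s <= v i -> v (i + d)%N <= t -> (d <= #|[set k | (s < y k < t)%R]%SET|)%N.
Proof.
move=> sep sv; suff ge_d t' : v (i + d)%N <= t' ->
    (s <= t') && (d <= #|[set k | (s < y k < t')%R]%SET|)%N by case/ge_d/andP.
elim: d => [|d IHd] in sep t' *; first by rewrite addn0 andbT; exact: le_trans.
rewrite addnS => vt'.
have /andP[svd d_le] : (s <= v (i + d)%N) &&
    (d <= #|[set k | (s < y k < v (i + d)%N)%R]%SET|)%N.
  by apply: IHd => // j /andP[ij jd]; apply: sep; rewrite ij addnS leqW.
have [|k /andP[vk kv]] := sep (i + d)%N; first by rewrite leq_addr addnS leqnn.
have kt' := lt_le_trans kv vt'; have vdt' := lt_trans vk kt'.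
rewrite (le_trans svd (ltW vdt')) /=.
apply: (@leq_trans #|k |: [set k | (s < y k < v (i + d)%N)%R]%SET|).
  by rewrite cardsU1 inE (lt_gtF vk) andbF.
apply/subset_leq_card/fintype.subsetP => l; rewrite !inE => /predU1P[->|/andP[-> lv]].
  by rewrite (le_lt_trans svd vk).
exact: lt_trans vdt'.
Qed.

Lemma nat_segment_in_itv (a b : R) : 0 <= a -> a + 2 <= b ->
  exists i d, [/\ a <= i%:R, (i + d)%:R <= b & b - a - 2 <= d%:R].
Proof.
move=> a_ge0 ab; pose i := (Num.trunc a).+1; pose l := Num.trunc b.
have ai : a < i%:R := truncnS_gt a.
have ia : i%:R <= a + 1 by rewrite -natr1 lerD2r truncn_le.
have lb : l%:R <= b by rewrite truncn_le; lra.
have bl : b < l%:R + 1 by rewrite natr1; exact: truncnS_gt.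
have il : (i <= l)%N by rewrite -(ler_nat R); lra.
by exists i, (l - i)%N; rewrite subnKC // natrB //; split; lra.
Qed.

Lemma near_card_eulerian_roots_ge s t : 0 < s -> s < t ->
  \forall n \near \oo, forall y : nat -> R, eulerian_roots n.+1 y ->
    n.+1%:R * (eulerian_cdf t - eulerian_cdf s) - 2 <=
    #|[set k : 'I_n.+1 | s < - y k.+1 < t]%SET|%:R.
Proof.
move=> s_gt0 st; have t_gt0 := lt_trans s_gt0 st.
have /andP[Fs_gt0 Fs_lt1] := eulerian_cdf_itv s.
have /andP[Ft_gt0 Ft_lt1] := eulerian_cdf_itv t.
have Fst := lt_eulerian_cdf s_gt0 st.
have [n0 _ n0P] := near_eulerian_rec_root_between Fs_gt0 Ft_lt1.
exists n0 => // n n0n y roots_y; set N : R := n.+2%:R.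
have N_gt0 : 0 < N by rewrite ltr0n.
apply: (@le_trans _ _ (N * eulerian_cdf t - N * eulerian_cdf s - 2)).
  by rewrite -mulrBr lerD2r ler_pM2r ?subr_gt0 // ler_nat.
have [F_lt2|F_ge2] := ltP (N * eulerian_cdf t) (N * eulerian_cdf s + 2).
  by apply: le_trans (ler0n _ _); lra.
have [|i [d [Fs_le le_Ft d_ge]]] := nat_segment_in_itv _ F_ge2.
  by rewrite mulr_ge0 // ltW.
apply: le_trans d_ge _; rewrite ler_nat.
have {}Fs_le j : (i <= j)%N -> eulerian_cdf s <= j%:R / N.
  by rewrite ler_pdivlMr // mulrC -(ler_nat R); exact: le_trans.
have {}le_Ft j : (j <= i + d)%N -> j%:R / N <= eulerian_cdf t.
  by rewrite ler_pdivrMr // mulrC -(ler_nat R) => /le_trans; apply.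
pose v j := eulerian_quantile (j%:R / N).
apply: (@card_separated_ge _ _ v i).
- move=> j /andP[ij jd]; have [||z] := n0P n.+1 (leqW n0n) j; [exact: Fs_le|exact: le_Ft|].
  rewrite -eulerian_polyE => /(eulerian_rootsP roots_y)[[//|k] /= kn ->] z_itv.
  by exists (Ordinal kn).
- rewrite -[leLHS]eulerian_cdfK // le_eulerian_quantile ?Fs_le //.
  by rewrite (le_lt_trans (le_Ft _ (leq_addr _ _))).
- rewrite -[leRHS]eulerian_cdfK // le_eulerian_quantile ?le_Ft //.
  by rewrite (lt_le_trans Fs_gt0) // Fs_le // leq_addr.
Qed.

Lemma root_measure_itv (y : nat -> R) n s t :
  root_measure y n.+1 `]s, t[%classic =
  (n.+1%:R^-1 * #|[set k : 'I_n.+1 | s < - y k.+1 < t]%SET|%:R)%:E.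
Proof.
rewrite /root_measure /mscale /= /msum EFinM; congr (_ * _)%E.
rewrite (eq_bigr (fun k : 'I_n.+1 => ((s < - y k.+1 < t)%R%:R : R)%:E)) => [|k _]; last first.
  rewrite /= diracE; congr ((nat_of_bool _)%:R%:E).
  by apply/idP/idP; rewrite inE /= in_itv.
rewrite sumEFin -sum1_card natr_sum [in RHS]big_mkcond; congr _%:E; apply: eq_bigr => k _.
by rewrite inE; case: ifP.
Qed.

Lemma near_root_measure_itv_ge (x : nat -> nat -> R) s t e :
  (forall n, (1 <= n)%N -> eulerian_roots n (x n)) -> 0 < s -> s < t -> 0 < e ->
  \forall n \near \oo, ((eulerian_cdf t - eulerian_cdf s - e)%:E <=
    root_measure (x n.+1) n.+1 `]s, t[%classic)%E.
Proof.
move=> roots_x s_gt0 st e_gt0; near=> n; rewrite root_measure_itv lee_fin.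
have n_gt0 : 0 < n.+1%:R :> R by [].
have e_ge : 2 / n.+1%:R <= e.
  near: n; apply: (cvgr_le (0 : R)) => //.
  exact: (@cvg_comp_div_natS R id 2 cvg_id).
rewrite mulrC ler_pdivlMr //; rewrite ler_pdivrMr // in e_ge.
apply: (@le_trans _ _ (n.+1%:R * (eulerian_cdf t - eulerian_cdf s) - 2)); first by lra.
have roots_n := roots_x n.+1 isT; move: (x n.+1) roots_n.
by near: n; exact: near_card_eulerian_roots_ge.
Unshelve. all: by end_near. Qed.

End root_count.

(** * Weak convergence *)

Section limn_einf_esup.
Context {R : realType}.
Implicit Types (u : (\bar R)^nat) (l : \bar R).

Lemma limn_einf_ge u l :
  (forall e : R, 0 < e -> \forall n \near \oo, (l - e%:E <= u n)%E) -> (l <= limn_einf u)%E.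
Proof.
move=> u_ge; apply/lee_addgt0Pr => e e_gt0; rewrite -leeBlDr //.
rewrite limn_einf_lim; apply: lime_ge; first exact: is_cvg_einfs.
have [n0 _ n0P] := u_ge _ e_gt0; exists n0 => // m n0m.
by apply: le_ereal_inf_tmp => _ [k /= mk <-]; apply: n0P; exact: leq_trans n0m mk.
Qed.

Lemma limn_esup_le_einf_cvg u l :
  (limn_esup u <= l)%E -> (l <= limn_einf u)%E -> u @ \oo --> l.
Proof.
move=> esup_le einf_ge.
have einfE : limn_einf u = l.
  by apply/eqP; rewrite eq_le einf_ge (le_trans (limn_einf_sup u)).
have esupE : limn_esup u = l.
  by apply/eqP; rewrite eq_le esup_le (le_trans einf_ge (limn_einf_sup u)).
apply: (@squeeze_cvge _ _ _ _ (einfs u) u (esups u)).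
- near=> n; rewrite ereal_inf_lbound ?ereal_sup_ubound //; by exists n => /=.
- by rewrite -einfE limn_einf_lim; exact: is_cvg_einfs.
- by rewrite -esupE limn_esup_lim; exact: is_cvg_esups.
Unshelve. all: by end_near. Qed.

End limn_einf_esup.

Section portmanteau.
Context {R : realType}.
Variables (mu_ : nat -> probability R R) (mu : probability R R).
Implicit Types (A B : set R) (f : R -> R) (a b e : R).

Definition liminf_ge A := forall e, 0 < e -> \forall n \near \oo, (mu A - e%:E <= mu_ n A)%E.

Lemma liminf_ge_set0 : liminf_ge set0.
Proof.
move=> e e_gt0; apply: nearW => n.
by rewrite !measure0 sub0e lee_fin oppr_le0 ltW.
Qed.

Lemma liminf_ge_setU A B : measurable A -> measurable B -> A `&` B = set0 ->
  liminf_ge A -> liminf_ge B -> liminf_ge (A `|` B).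
Proof.
move=> mA mB AB0 geA geB e e_gt0; have e2_gt0 : 0 < e / 2 by rewrite divr_gt0.
apply: filterS2 (geA _ e2_gt0) (geB _ e2_gt0) => n An Bn.
rewrite !measureU // (le_trans _ (leeD An Bn)) //.
by rewrite addeACA -oppeD // -EFinD -splitr.
Qed.

Lemma liminf_ge_bigcup (F : (set R)^nat) : (forall k, measurable (F k)) ->
  nondecreasing_seq F -> (forall k, liminf_ge (F k)) -> liminf_ge (\bigcup_k F k).
Proof.
move=> mF ndF geF e e_gt0; have e2_gt0 : 0 < e / 2 by rewrite divr_gt0.
have mUF : measurable (\bigcup_k F k) by exact: bigcup_measurable.
have muE A : measurable A -> mu A = (fine (mu A))%:E.
  by move=> mA; rewrite fineK // fin_num_measure.
have [k Fk] : exists k, (mu (\bigcup_k F k) - (e / 2)%:E <= mu (F k))%E.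
  have : mu (F k) @[k --> \oo] --> mu (\bigcup_k F k) by exact: nondecreasing_cvg_mu.
  rewrite [X in _ --> X]muE // => /fine_cvgP[_] /cvgrPdist_le.
  move=> /(_ _ e2_gt0)[k _ /(_ k (leqnn k)) Fk]; exists k.
  rewrite [leRHS]muE // (muE _ mUF) -EFinB lee_fin.
  by move: Fk; rewrite /= ler_norml => /andP[_]; lra.
apply: filterS (geF k _ e2_gt0) => n Fn.
apply: (@le_trans _ _ (mu_ n (F k))); last first.
  by apply: le_measure; rewrite ?inE //; exact: bigcup_sup.
apply: le_trans Fn; apply: le_trans (leeB Fk (lexx (e / 2)%:E)).
by rewrite -addeA -oppeD // -EFinD -splitr.
Qed.

Lemma liminf_ge_interval (I : set R) : (forall a b, a < b -> liminf_ge `]a, b[%classic) ->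
  open I -> is_interval I -> liminf_ge I.
Proof.
move=> ge_itv oI iI.
have -> : I = \bigcup_k (I `&` `]- k%:R, k%:R[%classic).
  by rewrite -setI_bigcupr bigcup_itvT setIT.
apply: liminf_ge_bigcup => [k|j k jk|k].
- apply: measurableI; [exact: open_measurable|exact: measurable_itv].
- apply/subsetPset; apply: setIS; apply: subset_itv; rewrite bnd_simp ?lerN2 ler_nat //.
set J := _ `&` _.
have oJ : open J by apply: openI => //; exact: interval_open.
have iJ : is_interval J.
  move=> x y [Ix kx] [Iy ky] z xzy; split; first exact: iI Ix Iy _ xzy.
  exact: interval_is_interval kx ky _ xzy.
have ubJ : has_ubound J by exists k%:R => x [_] /=; rewrite in_itv /= => /andP[_ /ltW].
have lbJ : has_lbound J by exists (- k%:R) => x [_] /=; rewrite in_itv /= => /andP[/ltW].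
have JE : J = `]inf J, sup J[%classic.
  rewrite -[LHS]((interior_id J).1 oJ) (interval_bounded_interior iJ lbJ ubJ).
  by apply/seteqP; split => x /=; rewrite in_itv.
have [ab|ba] := ltP (inf J) (sup J); first by rewrite JE; exact: ge_itv.
by rewrite JE set_itv_ge ?bnd_simp -?leNgt //; exact: liminf_ge_set0.
Qed.

Lemma liminf_ge_open (U : set R) : (forall a b, a < b -> liminf_ge `]a, b[%classic) ->
  open U -> liminf_ge U.
Proof.
move=> ge_itv oU; pose I := open_disjoint_itv oU.
have oI k : open (I k) := @open_disjoint_itv_open R U oU k.
have mI k : measurable (I k) by exact: open_measurable.
have geI k : liminf_ge (I k).
  by apply: liminf_ge_interval => //; exact: open_disjoint_itv_is_interval.
rewrite [U](@open_disjoint_itv_bigcup R U oU) -bigcup_bigsetU_bigcup.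
apply: liminf_ge_bigcup => [k|j k jk|k]; first exact: bigsetU_measurable.
  by apply/subsetPset; exact: subset_bigsetU.
elim: k.+1 => [|m IHm]; first by rewrite big_ord0; exact: liminf_ge_set0.
rewrite big_ord_recr; apply: liminf_ge_setU => //; first exact: bigsetU_measurable.
apply: (@trivIset_bigsetUI _ predT) => //.
exact: sub_trivIset (@subsetT _ _) (@open_disjoint_itv_trivIset R U oU).
Qed.

Lemma le_integral_limn_einf f : (forall a b, a < b -> liminf_ge `]a, b[%classic) ->
  continuous f -> (forall x, 0 <= f x) ->
  (\int[mu]_x (f x)%:E <= limn_einf (fun n => \int[mu_ n]_x (f x)%:E))%E.
Proof.
move=> ge_itv cf f_ge0.
have mf : f \in mfun by rewrite inE; exact: continuous_measurable_fun.
pose X (P : probability R R) : {RV P >-> R} := mfun_Sub mf.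
have ccdfE (P : probability R R) : (\int[P]_x (f x)%:E =
    \int[@lebesgue_measure R]_(r in `[0%R, +oo[) ccdf (X P) r)%E.
  by rewrite -ge0_expectation_ccdf // expectation_def.
under [X in limn_einf X]funext do rewrite ccdfE; rewrite ccdfE.
have mccdf P : measurable_fun (`[0%R, +oo[ : set R) (ccdf (X P)).
  by apply: measurable_funTS; exact: ccdf_measurable.
apply: le_trans (fatou _ _ _ _) => //; last by move=> n; exact: mccdf.
apply: ge0_le_integral => //; first exact: mccdf.
  apply: measurableT_comp => //; apply: measurable_fun_limn_esup => n.
  by apply: measurableT_comp => //; exact: mccdf.
move=> r _; apply: limn_einf_ge; apply: liminf_ge_open => //.
by apply: open_comp => [x _|]; [exact: cf|exact: interval_open].
Qed.

Lemma integrable_continuous_bounded (P : probability R R) f M :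
  continuous f -> (forall x, `|f x| <= M) -> P.-integrable setT (EFin \o f).
Proof.
move=> cf fM; apply: measurable_bounded_integrable => //.
- by rewrite (le_lt_trans (probability_le1 _ _)) ?ltry.
- exact: continuous_measurable_fun.
- by exists M; split=> [|N MN x _ /=]; [exact: num_real|exact: le_trans (fM x) (ltW MN)].
Qed.

Lemma integralDcst (P : probability R R) f M c : continuous f -> (forall x, `|f x| <= M) ->
  (\int[P]_x (c + f x)%:E = c%:E + \int[P]_x (f x)%:E)%E.
Proof.
move=> cf fM; under eq_integral do rewrite EFinD.
rewrite integralD //.
- by rewrite integral_cst // [X in (_ * X)%E](@probability_setT _ _ _ P) mule1.
- by apply: (@integrable_continuous_bounded _ (cst c) `|c|) => // x; exact: cvg_cst.
- exact: integrable_continuous_bounded cf fM.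
Qed.

Lemma le_integral_limn_einf_bounded f M : (forall a b, a < b -> liminf_ge `]a, b[%classic) ->
  continuous f -> (forall x, `|f x| <= M) ->
  (\int[mu]_x (f x)%:E <= limn_einf (fun n => \int[mu_ n]_x (f x)%:E))%E.
Proof.
move=> ge_itv cf fM; rewrite -(leeD2lE _ _ (_ : M%:E \is a fin_num)) //.
rewrite -limn_einf_shift // -(integralDcst mu M cf fM).
under [X in limn_einf X]funext do rewrite -(integralDcst _ M cf fM).
apply: le_integral_limn_einf => // x.
  by apply: cvgD; [exact: cvg_cst|exact: cf].
by have := fM x; rewrite ler_norml => /andP[? _]; lra.
Qed.

(* Lower bounds suffice, because they hold for both [f] and [- f]. *)
Lemma weakly_converges_itv :
  (forall a b, a < b -> liminf_ge `]a, b[%classic) -> weakly_converges mu_ mu.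
Proof.
move=> ge_itv f cf [M fM]; apply: limn_esup_le_einf_cvg; last first.
  exact: le_integral_limn_einf_bounded fM.
have NfM x : `|- f x| <= M by rewrite normrN.
have cNf : continuous (fun x => - f x) by move=> x; apply: cvgN; exact: cf.
have intN (P : probability R R) : (\int[P]_x (- f x)%:E = - \int[P]_x (f x)%:E)%E.
  by rewrite -integralN //; exact: integrable_add_def (integrable_continuous_bounded _ cf fM).
have := le_integral_limn_einf_bounded ge_itv cNf NfM.
rewrite intN; under [X in limn_einf X]funext do rewrite intN.
by rewrite limn_einfN leeN2.
Qed.

End portmanteau.

(** * The limit law *)

Section density_measure.
Context {R : realType}.
Variable f : R -> R.
Hypotheses (mf : measurable_fun setT f) (f_ge0 : forall x, 0 <= f x).

Definition density_measure of measurable_fun setT f & (forall x, 0 <= f x) :=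
  fun A : set R => (\int[@lebesgue_measure R]_(x in A) (f x)%:E)%E.

Let mu := density_measure mf f_ge0.

Let mu0 : mu set0 = 0%E. Proof. exact: integral_set0. Qed.

Let mu_ge0 A : (0 <= mu A)%E.
Proof. by apply: integral_ge0 => x _; rewrite lee_fin. Qed.

Let mu_sigma_additive : semi_sigma_additive mu.
Proof.
move=> F mF tF mUF; rewrite /mu /density_measure ge0_integral_bigcup //=.
- apply: is_cvg_nneseries => n _ _; exact: mu_ge0.
- by apply/measurable_EFinP; exact: measurable_funTS.
- by move=> x _; rewrite lee_fin.
Qed.

HB.instance Definition _ := isMeasure.Build _ _ _ mu mu0 mu_ge0 mu_sigma_additive.

End density_measure.

Section measure_on_reals.
Context {R : realType}.
Local Notation leb := (@lebesgue_measure R).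

Lemma measure_itv_oc_unique (m1 m2 : {measure set R -> \bar R}) :
  (forall a b, a < b -> (m1 `]a, b]%classic < +oo)%E) ->
  (forall a b, a < b -> m1 `]a, b]%classic = m2 `]a, b]%classic) ->
  forall A, measurable A -> m1 A = m2 A.
Proof.
move=> m1_fin m12 A mA.
apply: (measure_unique (@ocitv R) (fun n => `](- n.+1%:R), n.+1%:R]%classic)) => //.
- exact: ocitvI.
- by move=> n; exact: is_ocitv.
- apply/seteqP; split => // x _; exists (Num.trunc `|x|) => //=; rewrite in_itv /=.
  by have := truncnS_gt `|x|; rewrite ltr_norml => /andP[-> /ltW].
- move=> _ [[a b] _ <-] /=; have [ab|ba] := ltP a b; first exact: m12.
  by rewrite set_itv_ge ?bnd_simp -?leNgt // !measure0.
- by move=> n; apply: m1_fin; rewrite gtrN.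
Qed.

Lemma integral_itv_oc_derive (F f : R -> R) (s t : R) : s < t ->
  (forall x, s <= x <= t -> is_derive x 1 F (f x)) ->
  (forall x, s <= x <= t -> {for x, continuous f}) ->
  (\int[leb]_(x in `]s, t]) (f x)%:E = (F t - F s)%:E)%E.
Proof.
move=> st dF cf.
have cwf : {within `[s, t], continuous f}.
  by apply: continuous_in_subspaceT => x; rewrite inE /= in_itv; exact: cf.
have cF x : s <= x <= t -> {for x, continuous F}.
  by move=> /dF[dFx _]; exact/differentiable_continuous/derivable1_diffP.
rewrite integral_itv_obnd_cbnd; last first.
  apply/measurable_EFinP; apply: measurable_funS (subspace_continuous_measurable_fun _ cwf) => //.
  exact: subset_itv_oc_cc.
rewrite EFinB; apply: continuous_FTC2 => //.
- split.
  + by move=> x /subset_itv_oo_cc; rewrite in_itv /= => /dF[].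
  + by apply: cvg_at_right_filter; apply: cF; rewrite lexx ltW.
  + by apply: cvg_at_left_filter; apply: cF; rewrite lexx ltW.
- by move=> x /subset_itv_oo_cc; rewrite in_itv /= derive1E => /dF[_].
Qed.

End measure_on_reals.

Section cauchy_law.
Context {R : realType}.
Implicit Types (s t : R).

Let pi_gt0 : 0 < pi :> R := pi_gt0 R.

Lemma standard_cauchy_pdf_ge0 (x : R) : 0 <= standard_cauchy_pdf x.
Proof. by rewrite invr_ge0 mulr_ge0 ?(ltW pi_gt0) // addr_ge0 ?sqr_ge0. Qed.

Lemma standard_cauchy_pdfE :
  @standard_cauchy_pdf R = (fun x => pi^-1 * (oneDsqr x)^-1).
Proof. by apply/funext => x; rewrite -invfM. Qed.

Lemma continuous_standard_cauchy_pdf : continuous (@standard_cauchy_pdf R).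
Proof.
rewrite standard_cauchy_pdfE => x.
by apply: cvgM; [exact: cvg_cst|exact: continuous_oneDsqrV].
Qed.

Lemma measurable_standard_cauchy_pdf : measurable_fun setT (@standard_cauchy_pdf R).
Proof. exact: continuous_measurable_fun continuous_standard_cauchy_pdf. Qed.

Definition cauchy_law : set R -> \bar R :=
  density_measure measurable_standard_cauchy_pdf standard_cauchy_pdf_ge0.

HB.instance Definition _ := Measure.on cauchy_law.

Lemma cauchy_law_itv s t : s < t -> cauchy_law `]s, t] = ((atan t - atan s) / pi)%:E.
Proof.
move=> st; rewrite mulrBl; apply: (@integral_itv_oc_derive R (fun x => atan x / pi)) => [//|x|x] _.
  have -> : (fun x : R => atan x / pi) = pi^-1 \*: (@atan R).
    by apply/funext => y; rewrite /= mulrC.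
  by rewrite standard_cauchy_pdfE; apply: is_deriveZ; exact: is_derive1_atan.
exact: continuous_standard_cauchy_pdf.
Qed.

Let cauchy_law_setT : cauchy_law setT = 1%E.
Proof.
rewrite /cauchy_law /density_measure ge0_symfun_integralT.
- rewrite -set_itvcy standard_cauchy_pdfE.
  under eq_integral do rewrite EFinM.
  rewrite ge0_integralZl_EFin //.
  + by rewrite integral0y_oneDsqr -!EFinM mulKf ?divff // gt_eqF.
  + apply/measurable_EFinP; apply: measurable_funTS.
    exact: continuous_measurable_fun (@continuous_oneDsqrV R).
  + by rewrite invr_ge0 ltW.
- exact: standard_cauchy_pdf_ge0.
- exact: continuous_standard_cauchy_pdf.
- by move=> x; rewrite /standard_cauchy_pdf /= sqrrN.
Qed.

HB.instance Definition _ := Measure_isProbability.Build _ _ R cauchy_law cauchy_law_setT.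

End cauchy_law.

Section eulerian_law.
Context {R : realType}.
Implicit Types (s t : R) (A : set R).
Local Notation leb := (@lebesgue_measure R).

Let pi_gt0 : 0 < pi :> R := pi_gt0 R.

Definition eulerian_density t : R :=
  if 0 < t then (t * (ln t ^+ 2 + pi ^+ 2))^-1 else 0.

Lemma eulerian_density_ge0 t : 0 <= eulerian_density t.
Proof.
rewrite /eulerian_density; case: ifP => // t_gt0.
by rewrite invr_ge0 mulr_ge0 ?addr_ge0 ?sqr_ge0 // ltW.
Qed.

Lemma continuous_eulerian_density t : 0 < t -> {for t, continuous eulerian_density}.
Proof.
move=> t_gt0; have den_cont :
    (fun x => (x * (ln x ^+ 2 + pi ^+ 2))^-1) @ t --> eulerian_density t.
  rewrite /eulerian_density t_gt0; apply: cvgV.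
    by rewrite gt_eqF // mulr_gt0 // ltr_wpDl ?sqr_ge0 // exprn_gt0.
  apply: cvgM; first exact: cvg_id.
  apply: cvgD; last exact: cvg_cst.
  exact: (cvg_comp _ _ (continuous_ln t_gt0) (@exprn_continuous R 2 (ln t))).
apply: cvg_trans den_cont; apply: near_eq_cvg; near=> x.
by rewrite /eulerian_density ifT //; near: x; exact: lt_nbhsr.
Unshelve. all: by end_near. Qed.

Lemma eulerian_density_restrict : eulerian_density = eulerian_density \_ `]0, +oo[.
Proof.
apply/funext => t; rewrite patchE /eulerian_density.
case: ifPn => [t_gt0|_]; last by case: ifP.
by rewrite ifT // inE /= in_itv /= t_gt0.
Qed.

Lemma measurable_eulerian_density : measurable_fun setT eulerian_density.
Proof.
rewrite eulerian_density_restrict; apply/(measurable_restrictT _ _).1 => //.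
apply: open_continuous_measurable_fun => // t; rewrite inE /= in_itv /= andbT.
exact: continuous_eulerian_density.
Qed.

Lemma is_derive_eulerian_cdf t : 0 < t -> is_derive t 1 eulerian_cdf (eulerian_density t).
Proof.
move=> t_gt0; have d_arg : is_derive t 1 (fun x => ln x / pi) (t^-1 / pi).
  have -> : (fun x => ln x / pi) = pi^-1 \*: (@ln R) by apply/funext => x; rewrite /= mulrC.
  by rewrite [_ / _]mulrC; apply: is_deriveZ; exact: is_derive1_ln.
have := @is_derive1_comp _ atan (fun x => ln x / pi) t _ _ (is_derive1_atan _) d_arg.
move=> /(is_deriveZ (pi^-1)) /(is_deriveD (is_derive_cst (1 / 2 : R) t 1)) d_cdf.
have -> : @eulerian_cdf R = (fun x : R => 1 / 2 + pi^-1 * atan (ln x / pi)).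
  by apply/funext => x; rewrite /eulerian_cdf [pi^-1 * _]mulrC.
apply: is_derive_eq d_cdf _; rewrite add0r /eulerian_density t_gt0.
have den_neq0 : pi ^+ 2 + ln t ^+ 2 != 0 by rewrite gt_eqF // ltr_wpDr ?sqr_ge0 // exprn_gt0.
rewrite -[LHS]/(_ * _).
move: (@pi R) (lt0r_neq0 pi_gt0) den_neq0 => p p_neq0 den_neq0.
by field; rewrite addrC den_neq0 p_neq0 gt_eqF.
Qed.

Lemma integral_eulerian_density s t : 0 < s -> s < t ->
  (\int[leb]_(x in `]s, t]) (eulerian_density x)%:E = (eulerian_cdf t - eulerian_cdf s)%:E)%E.
Proof.
move=> s_gt0 st.
apply: (@integral_itv_oc_derive R eulerian_cdf eulerian_density) => [//|x|x] /andP[sx _].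
  by apply: is_derive_eulerian_cdf; exact: lt_le_trans sx.
by apply: continuous_eulerian_density; exact: lt_le_trans sx.
Qed.

#[local] HB.instance Definition _ :=
  isMeasurableFun.Build _ _ R R (@idfun R) (@measurable_id _ R setT).

Definition eulerian_law := distribution (@cauchy_law R) (exp_pi (@idfun R)).

HB.instance Definition _ := Probability.on eulerian_law.

Lemma preimage_exp_pi_itv s t : 0 < s -> 0 < t ->
  exp_pi (@idfun R) @^-1` `]s, t] = `](ln s / pi), (ln t / pi)]%classic.
Proof.
move=> s_gt0 t_gt0; have itvE x : (s < expR (pi * x) <= t) = (ln s / pi < x <= ln t / pi).
  rewrite ltr_pdivrMr // ler_pdivlMr // [x * pi]mulrC.
  by rewrite -[s in LHS]lnK ?posrE // -[t in LHS]lnK ?posrE // ltr_expR ler_expR.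
by apply/seteqP; split => x; rewrite /= !in_itv /= itvE.
Qed.

Lemma ln_div_pi_preimage_itv (a b : R) :
  (fun x : R => ln x / pi) @^-1` `]a, b] `&` `]0, +oo[ =
  `](expR (pi * a)), (expR (pi * b))]%classic.
Proof.
have itvE x : 0 < x -> (a < ln x / pi <= b) = (expR (pi * a) < x <= expR (pi * b)).
  move=> x_gt0; rewrite ltr_pdivlMr // ler_pdivrMr // ![_ * pi]mulrC.
  by rewrite -[x in RHS]lnK ?posrE // ltr_expR ler_expR.
apply/seteqP; split => x; rewrite /= !in_itv /= ?andbT.
  by move=> [+ x_gt0]; rewrite itvE.
move=> x_itv; have x_gt0 : 0 < x.
  by case/andP: x_itv => + _; apply: lt_trans; exact: expR_gt0.
by rewrite itvE.
Qed.

Lemma eulerian_law_itv s t : 0 < s -> s < t ->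
  eulerian_law `]s, t]%classic = (eulerian_cdf t - eulerian_cdf s)%:E.
Proof.
move=> s_gt0 st; have t_gt0 := lt_trans s_gt0 st.
transitivity (cauchy_law `](ln s / pi), (ln t / pi)]%classic).
  by rewrite -preimage_exp_pi_itv.
rewrite cauchy_law_itv ?ltr_pM2r ?invr_gt0 // ?ltr_ln //.
by congr _%:E; rewrite /eulerian_cdf mulrBl; ring.
Qed.

Lemma eulerian_law_setI_pos A : eulerian_law (A `&` `]0, +oo[) = eulerian_law A.
Proof.
congr cauchy_law.
by apply/seteqP; split => [x []//|x Ax]; split; rewrite //= in_itv /= expR_gt0.
Qed.

Lemma integral_eulerian_density_setI_pos A : measurable A ->
  (\int[leb]_(x in A `&` `]0%R, +oo[) (eulerian_density x)%:E =
   \int[leb]_(x in A) (eulerian_density x)%:E)%E.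
Proof.
move=> mA; rewrite integral_mkcondr; apply: eq_integral => x _.
by rewrite [in RHS]eulerian_density_restrict !patchE; case: ifP.
Qed.

(* Both laws are compared on the half-open intervals after the change of variable [ln t / pi],
   which makes them probabilities on the whole line. *)
Lemma eulerian_law_density : has_density eulerian_law eulerian_density.
Proof.
split; [exact: measurable_eulerian_density|exact: eulerian_density_ge0|move=> A mA].
pose nu := density_measure measurable_eulerian_density eulerian_density_ge0.
pose g x : R := ln x / pi.
have mg : g \in mfun by rewrite inE; apply: measurable_funM.
pose gnu := pushforward nu (mfun_Sub mg).
have gnuE B : measurable B ->
    gnu B = (\int[leb]_(x in g @^-1` B `&` `]0%R, +oo[) (eulerian_density x)%:E)%E.
  move=> mB; rewrite integral_eulerian_density_setI_pos //.
  exact: (measurable_funPTI (mfun_Sub mg) mB).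
have gnu_itv (a b : R) : a < b -> cauchy_law `]a, b]%classic = gnu `]a, b]%classic.
  move=> ab; rewrite cauchy_law_itv // gnuE //.
  rewrite ln_div_pi_preimage_itv integral_eulerian_density ?expR_gt0 //.
    by congr _%:E; rewrite /eulerian_cdf !expRK ![pi * _]mulrC !mulfK ?gt_eqF //; ring.
  by rewrite ltr_expR ltr_pM2l.
rewrite -integral_eulerian_density_setI_pos //.
transitivity (gnu (exp_pi (@idfun R) @^-1` A)).
  rewrite -[LHS]/(cauchy_law (exp_pi idfun @^-1` A)).
  apply: (@measure_itv_oc_unique R (@cauchy_law R) gnu) => //.
  - by move=> a b ab; rewrite (le_lt_trans (probability_le1 _ _)) // ltry.
  - exact: measurable_funPTI.
rewrite gnuE; last exact: measurable_funPTI.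
have gK x : 0 < x -> exp_pi idfun (g x) = x.
  by move=> x_gt0; rewrite /exp_pi /g mulrC divfK ?gt_eqF // lnK.
congr integral; apply/seteqP; split => x [Ax]; rewrite /= in_itv /= andbT => x_gt0.
  by move: Ax; rewrite /= gK.
by rewrite /= gK.
Qed.

Lemma eulerian_law_support : measure_support eulerian_law = [set t | 0 <= t].
Proof.
apply/seteqP; split => t /= t_in.
  rewrite leNgt; apply/negP => t_lt0.
  have := t_in `]-oo, 0[%classic (interval_open _ _); rewrite /= in_itv /= => /(_ isT isT t_lt0).
  rewrite -eulerian_law_setI_pos [X in eulerian_law X](_ : _ = set0) ?measure0 ?ltxx //.
  apply/seteqP; split => // x [] /=; rewrite !in_itv /= andbT => x_lt0 x_gt0.
  by have := lt_trans x_lt0 x_gt0; rewrite ltxx.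
move=> U oU Ut; have [e /= e_gt0 tU] : nbhs t U by exact: open_nbhs_nbhs.
have itvU : `](t + e / 4), (t + e / 2)]%classic `<=` U.
  move=> x; rewrite /= in_itv /= => /andP[x_gt x_le]; apply: tU => /=.
  by rewrite ltr_norml; apply/andP; split; lra.
apply: (@lt_le_trans _ _ (eulerian_law `](t + e / 4), (t + e / 2)]%classic)); last first.
  by apply: le_measure; rewrite ?inE //; exact: open_measurable.
rewrite eulerian_law_itv; [|lra|lra].
by rewrite lte_fin subr_gt0 lt_eulerian_cdf //; lra.
Qed.

Lemma distribution_exp_cauchy (d : measure_display) (T : measurableType d)
    (P : probability T R) (Z : {RV P >-> R}) A :
  has_density (distribution P Z) (@standard_cauchy_pdf R) -> measurable A ->
  eulerian_law A = distribution P (exp_pi Z) A.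
Proof.
move=> [_ _ Z_density] mA; apply/esym.
by apply: (Z_density (exp_pi idfun @^-1` A)); exact: measurable_funPTI.
Qed.

Lemma eulerian_roots_liminf_ge (x : nat -> nat -> R) a b :
  (forall n, (1 <= n)%N -> eulerian_roots n (x n)) -> a < b ->
  liminf_ge (fun n => root_measure (x n.+1) n.+1) eulerian_law `]a, b[%classic.
Proof.
move=> roots_x ab.
have ge_pos (s t : R) : 0 < s -> s < t ->
    liminf_ge (fun n => root_measure (x n.+1) n.+1) eulerian_law `]s, t[%classic.
  move=> s_gt0 st e e_gt0; have := near_root_measure_itv_ge roots_x s_gt0 st e_gt0.
  apply: filterS => n; apply: le_trans; rewrite EFinB leeB // -eulerian_law_itv //.
  by apply: le_measure; rewrite ?inE //; exact: subset_itv_oo_oc.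
have [|a_le0] := ltP 0 a; first by move=> /ge_pos; exact.
pose F k : set R := `]k.+1%:R^-1, b[%classic.
have F_cup : \bigcup_k F k = `]0, b[%classic.
  apply/seteqP; split => t; rewrite /F /= in_itv /=.
    move=> [k _]; rewrite /= in_itv /= => /andP[t_gt ->]; rewrite andbT.
    by apply: lt_trans t_gt; rewrite invr_gt0.
  move=> /andP[t_gt0 tb]; exists (Num.trunc t^-1) => //=.
  by rewrite in_itv /= tb andbT invf_plt ?posrE // truncnS_gt.
have : liminf_ge (fun n => root_measure (x n.+1) n.+1) eulerian_law (\bigcup_k F k).
  apply: liminf_ge_bigcup => [k|j k jk|k]; first exact: measurable_itv.
    apply/subsetPset; apply: subset_itvr; rewrite bnd_simp.
    by rewrite lef_pV2 ?posrE // ler_nat ltnS.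
  have [kb|bk] := ltP (k.+1%:R^-1) b; first exact: ge_pos.
  by rewrite /F set_itv_ge ?bnd_simp -?leNgt //; exact: liminf_ge_set0.
rewrite F_cup => ge0b e /ge0b; apply: filterS => n ge0b_n.
apply: le_trans (le_trans ge0b_n _); last first.
  by apply: le_measure; rewrite ?inE //; apply: subset_itvr; rewrite bnd_simp.
rewrite leeB // -[leLHS](eulerian_law_setI_pos `]a, b[); apply: le_measure; rewrite ?inE //.
  exact: measurableI.
by move=> t []; rewrite /= !in_itv /= andbT => /andP[_ ->] ->.
Qed.

End eulerian_law.

Theorem theorem1 (R : realType) (x : nat -> nat -> R)
    (hx : forall n : nat, (1 <= n)%N -> eulerian_roots n (x n)) :
  exists mu : probability R R,
    [/\ weakly_converges (fun n : nat => root_measure (x n.+1) n.+1) mu,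
        measure_support mu = [set t : R | 0 <= t],
        forall (d : measure_display) (T : measurableType d)
          (P : probability T R) (Z : {RV P >-> R}),
          has_density (distribution P Z) (@standard_cauchy_pdf R) ->
          forall A : set R, measurable A ->
            mu A = distribution P (exp_pi Z) A
      & has_density mu (fun t : R =>
          if 0 < t then (t * (ln t ^+ 2 + pi ^+ 2))^-1 else 0)].
Proof.
exists eulerian_law; split.
- by apply: weakly_converges_itv => a b; exact: eulerian_roots_liminf_ge.
- exact: eulerian_law_support.
- by move=> d T P Z Z_cauchy A; exact: distribution_exp_cauchy.
- exact: eulerian_law_density.
Qed.
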